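(* Let $k,n_1,n_2,\dots,n_k$ be positive integers with $k>1$, and let $N=\{i\in[k]: n_i>2\}$ be the set of indices of blocks containing more than two vertices. If $N$ is non-empty, then \[ \operatorname{MLdeg}(n_1,n_2,\dots,n_k)=\prod_{i\in N}\operatorname{MLdeg}(n_i,1)=\prod_{i\in N}\bigl(2^{n_i}-(n_i+1)\bigr), \] and otherwise (when all blocks have size $1$ or $2$) $\operatorname{MLdeg}(n_1,\dots,n_k)=1$.
   Context: Write $[m]=\{1,\dots,m\}$. Let $k\ge 1$ and let $n_1,\dots,n_k$ be positive integers with $n_1+\cdots+n_k\ge 2$. The $\beta$-stochastic blockmodel ($\beta$-SBM) $M=\mathcal{M}(n_1,\dots,n_k)$ has $k$ blocks of vertices $V_i=\{(i,v):1\le v\le n_i\}$, $i\in[k]$, and vertex set $V=\bigcup_i V_i$. The set of potential edges $E$ is the set of all unordered pairs of distinct vertices; the pair $\{(i,v),(j,w)\}$ is written $(i,v)(j,w)$. Points of $\mathbb{C}^{|E|}$ have coordinates $p_{(i,v)(j,w)}=p_{(j,w)(i,v)}$ indexed by $E$. Design matrix: $A$ is the zero-one matrix with columns indexed by $E$, with one row $\beta_{(\ell,x)}$ for each vertex $(\ell,x)\in V$ and one row $\alpha_{\ell_1,\ell_2}$ for each unordered pair of blocks $\ell_1,\ell_2\in[k]$ (with $\ell_1=\ell_2$ allowed). The entry in row $\beta_{(\ell,x)}$ and column $(i,v)(j,w)$ is $1$ if $(\ell,x)\in\{(i,v),(j,w)\}$ and $0$ otherwise; the entry in row $\alpha_{\ell_1,\ell_2}$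 and column $(i,v)(j,w)$ is $1$ if $\{\ell_1,\ell_2\}=\{i,j\}$ and $0$ otherwise. Likelihood equations: given $\mathbf{u}\in\mathbb{C}^{|E|}$, the system $L(M)$ in the unknown $\mathbf{p}\in\mathbb{C}^{|E|}$ consists of the linear equations $A(\mathbf{p}-\mathbf{u})=\mathbf{0}$ together with all quadratic equations of the following types (blocks named by different letters are distinct, and vertices named differently within one block are distinct): - within block: $p_{(i,t)(i,u)}p_{(i,v)(i,w)}-p_{(i,t)(i,v)}p_{(i,u)(i,w)}=0$; - 3-1: $p_{(i,t)(j,w)}p_{(i,u)(i,v)}-p_{(i,t)(i,u)}p_{(i,v)(j,w)}=0$; - 2-2: $p_{(i,t)(j,v)}p_{(i,u)(j,w)}-p_{(i,t)(j,w)}p_{(i,u)(j,v)}=0$; - 2-1-1: $p_{(i,t)(j,v)}p_{(i,u)(l,w)}-p_{(i,t)(l,w)}p_{(i,u)(j,v)}=0$. The quadratic binomials generate the toric ideal $I_A$ of the model. The maximum likelihood degree $\operatorname{MLdeg}(M)=\operatorname{MLdeg}(n_1,\dots,n_k)$ is the number of solutions $\mathbf{p}\in\mathbb{C}^{|E|}$ of $L(M)$ for generic $\mathbf{u}\in\mathbb{C}^{|E|}$ (that is, for $\mathbf{u}$ outside some proper Zariski-closed subset). In particular $\operatorname{MLdeg}(n_i,1)$ refers to the model with two blocks, of sizes $n_i$ and $1$. *)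

(* Defs.v *)
From mathcomp Require Import all_boot all_order all_algebra.
From mathcomp Require Import boolp classical_sets cardinality reals complex.
From mathcomp Require mpoly.

Set Implicit Arguments.
Unset Strict Implicit.
Unset Printing Implicit Defensive.

Import GRing.Theory.
Local Open Scope ring_scope.
Local Open Scope card_scope.

Definition zariski_closed (K : fieldType) (m : nat) (Z : set 'cV[K]_m) : Prop :=
  exists F : set (mpoly.mpoly m K),
    forall u, Z u <-> forall f, F f -> mpoly.meval (fun j => u j ord0) f = 0.

Definition generically (K : fieldType) (m : nat) (P : 'cV[K]_m -> Prop) : Prop :=
  exists Z : set 'cV[K]_m,
    [/\ zariski_closed Z, Z <> setT & forall u, ~ Z u -> P u].

Section BetaSBM.
Variables (K : fieldType) (k : nat) (n : 'I_k -> nat).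

Definition vertex : finType := {i : 'I_k & 'I_(n i)}.

Definition vtx (i : 'I_k) (v : 'I_(n i)) : vertex := Tagged (fun i => 'I_(n i)) v.

Definition edge : finType := {e : {set vertex} | #|e| == 2%N}.

(* An unordered pair of blocks, the two blocks being possibly equal. *)
Definition block_pair : finType := {b : {set 'I_k} | (0 < #|b| <= 2)%N}.

Definition parameter : finType := (vertex + block_pair)%type.

Definition design_entry (r : parameter) (e : edge) : bool :=
  match r with
  | inl x => x \in val e
  | inr b => val b == [set tag y | y in val e]%SET
  end.

Definition design_mx : 'M[K]_(#|parameter|, #|edge|) :=
  \matrix_(r, e) (design_entry (enum_val r) (enum_val e))%:R.

(* Meaningful for x != y only; the junk value 0 at x = y is never used. *)
Definition coord (p : 'cV[K]_#|edge|) (x y : vertex) : K :=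
  if insub [set x; y]%SET is Some e then p (enum_rank (e : edge)) ord0 else 0.

Definition within_block_eqs (p : 'cV[K]_#|edge|) : Prop :=
  forall (i : 'I_k) (t u v w : 'I_(n i)), uniq [:: t; u; v; w] ->
    coord p (vtx t) (vtx u) * coord p (vtx v) (vtx w)
    - coord p (vtx t) (vtx v) * coord p (vtx u) (vtx w) = 0.

Definition three_one_eqs (p : 'cV[K]_#|edge|) : Prop :=
  forall (i j : 'I_k) (t u v : 'I_(n i)) (w : 'I_(n j)),
    i != j -> uniq [:: t; u; v] ->
    coord p (vtx t) (vtx w) * coord p (vtx u) (vtx v)
    - coord p (vtx t) (vtx u) * coord p (vtx v) (vtx w) = 0.

Definition two_two_eqs (p : 'cV[K]_#|edge|) : Prop :=
  forall (i j : 'I_k) (t u : 'I_(n i)) (v w : 'I_(n j)),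
    i != j -> t != u -> v != w ->
    coord p (vtx t) (vtx v) * coord p (vtx u) (vtx w)
    - coord p (vtx t) (vtx w) * coord p (vtx u) (vtx v) = 0.

Definition two_one_one_eqs (p : 'cV[K]_#|edge|) : Prop :=
  forall (i j l : 'I_k) (t u : 'I_(n i)) (v : 'I_(n j)) (w : 'I_(n l)),
    uniq [:: i; j; l] -> t != u ->
    coord p (vtx t) (vtx v) * coord p (vtx u) (vtx w)
    - coord p (vtx t) (vtx w) * coord p (vtx u) (vtx v) = 0.

Definition likelihood_eqs (u p : 'cV[K]_#|edge|) : Prop :=
  design_mx *m (p - u) = 0 /\
  [/\ within_block_eqs p, three_one_eqs p, two_two_eqs p & two_one_one_eqs p].

Definition generic_solution_count (d : nat) : Prop :=
  generically (fun u => [set p | likelihood_eqs u p]%classic #= `I_d).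

End BetaSBM.

(* Two nonempty Zariski open subsets of complex affine space meet, so at most
   one d qualifies.  The value is 0 if none does; hence MLdeg R n = d with
   0 < d does assert that the generic number of solutions exists and is d. *)
Definition MLdeg (R : realType) (k : nat) (n : 'I_k -> nat) : nat :=
  xget 0%N (generic_solution_count R[i] n).

(* Main.v *)
From mathcomp Require Import boolp classical_sets cardinality complex.
From mathcomp Require Import separable mpoly ring.
From mathcomp Require Import all_boot all_order all_algebra.
From mathcomp Require Import reals.
Require Import Defs.
Set Implicit Arguments.
Unset Strict Implicit.
Unset Printing Implicit Defensive.
Import Order.TTheory GRing.Theory Num.Theory.
Local Open Scope ring_scope.

(** The blocks decouple.  For a solution [p], the 2-2 and 2-1-1 equations say that,
    for each block [i], the matrix of the weights between [i] and its outside has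
    rank at most one.  Since the block sums [S i j] are prescribed by [u], such a
    [p] is
      [p (i,t) (j,w) = S i j * X t * X w / (T i * T j)]  for [i <> j],
    where [X t] is the total weight going from [t] to the outside of its block
    and [T i], the sum of the [S i j] over [j <> i], is nonzero for generic [u].
    Collapsing the outside of block [i] to a single vertex thus loses nothing,
    and the equations that remain are those of the plain beta model on a complete
    graph with [m = n i + 1] vertices: weights [M a b] with
    [M a b * M c e = M a c * M b e] and prescribed vertex degrees [d a].  Hence the number of solutions is the product over the blocks
    of the counts for these complete graphs, and the case of the sizes
    [n i, 1] has the same nontrivial factor ([toric_collapse], [decouple_inj],
    [decouple_build]).

    For [m <= 3] the degrees determine the weights.  For [m >= 4] and generic [d]
    all weights are nonzero, so the matrix has the form
      [M a b = (1 + y a) * (1 + y b) / s],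
    and the degree equations become [y a ^+ 2 = 1 - d a * s] together with
    [\sum_a y a = 2 - m].  Eliminating the square roots, [s] is a nonzero
    root of
      [Q s = \prod_e (2 - m - \sum_a (-1) ^+ e a * sqrt (1 - d a * s))],
    the product being over all sign patterns [e]; as it is invariant under the
    sign changes of the roots, [Q] is a polynomial in [s] and [d].  Its degree is
    [2 ^ (m - 1)].  At [s = 0] all roots are 1 up to sign, and the factors
    that vanish there are those of the [m] patterns with a single plus; each
    vanishes to first order, so [Q] is [s ^ m] times a polynomial of degree
    [2 ^ (m - 1) - m] that is nonzero at 0 ([elim_poly_order],
    [elim_poly_roots]).

    It remains that, for generic [d], this cofactor has simple roots and that each
    root carries one sign pattern only.  The second point follows from the first:
    two patterns at the same [s] make a double root
    ([elim_poly_double_root]).  For the first, a cofactor which is not separable over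
    the ring of polynomials in [d] has a square factor [A ^+ 2].  Moving only the
    coordinate [d 0], which occurs under a single square root, one finds for almost every
    value a nonzero [s] at which [A] vanishes, hence at which [Q] has a double root as a
    polynomial in [d 0].  But there [Q] is an explicit product of affine functions of
    [d 0], so two sign patterns of the other square roots coincide at [s], which forces [s]
    into a finite set that does not depend on [d 0]; this is absurd, because each such [s]
    is compatible with finitely many values of [d 0] only ([tail_separable]). *)

(** * Products over all sign choices of square roots *)

Section SignNorm.
Variable R : comNzRingType.

(** The norm of [F ('X + Y)] from the quadratic extension defined by [Y ^+ 2 = s]:
    it eliminates [Y] without requiring [s] to have a square root, so that it
    makes sense over rings of polynomials and commutes with ring morphisms. *)
Definition pair_norm (s : R) (F : {poly R}) : {poly R} :=
  let G := F^:P \Po ('X + 'X%:P) in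
  (even_poly G).[s%:P] ^+ 2 - s%:P * (odd_poly G).[s%:P] ^+ 2.

Lemma pair_normE (y : R) (F : {poly R}) :
  pair_norm (y ^+ 2) F = (F \Po ('X + y%:P)) * (F \Po ('X - y%:P)).
Proof.
rewrite /pair_norm; set G := F^:P \Po _.
have evG c : F \Po ('X + c%:P) = G.[c%:P].
  by rewrite horner_comp /= hornerD hornerX hornerC addrC.
rewrite -polyCN !evG -{3 4}(poly_even_odd G) !(hornerE, horner_comp).
by rewrite -!rmorphXn /= sqrrN; ring.
Qed.

(** The polynomial whose roots are all [\sum_i +- sqrt (s i)], obtained by
    adjoining the square roots one at a time. *)
Fixpoint sign_norm (m : nat) : ('I_m -> R) -> {poly R} :=
  if m is m'.+1 then
    fun s => pair_norm (s ord0) (sign_norm (fun i : 'I_m' => s (lift ord0 i)))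
  else fun=> 'X.

Definition signed_sum (m : nat) (e : {ffun 'I_m -> bool}) (y : 'I_m -> R) : R :=
  \sum_i (-1) ^+ e i * y i.

Definition cons_sign (m : nat) (be : bool * {ffun 'I_m -> bool}) :
    {ffun 'I_m.+1 -> bool} :=
  [ffun i => if unlift ord0 i is Some j then be.2 j else be.1].

Lemma cons_sign_bij m : bijective (@cons_sign m).
Proof.
exists (fun e : {ffun 'I_m.+1 -> bool} => (e ord0, [ffun i => e (lift ord0 i)])).
  move=> [b e]; rewrite /cons_sign ffunE unlift_none /=; congr pair.
  by apply/ffunP=> i; rewrite !ffunE liftK.
move=> e; apply/ffunP=> i; rewrite ffunE /=.
by case: (unliftP ord0 i) => [j|] ->; rewrite ?ffunE.
Qed.

Lemma signed_sum_cons m b (e : {ffun 'I_m -> bool}) y :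
  signed_sum (cons_sign (b, e)) y =
  (-1) ^+ b * y ord0 + signed_sum e (fun i => y (lift ord0 i)).
Proof.
rewrite /signed_sum big_ord_recl ffunE unlift_none /=; congr (_ + _).
by apply: eq_bigr => i _; rewrite ffunE liftK.
Qed.

Lemma big_cons_sign m (F : {ffun 'I_m.+1 -> bool} -> R) :
  \prod_e F e = \prod_(e : {ffun 'I_m -> bool})
                   (F (cons_sign (false, e)) * F (cons_sign (true, e))).
Proof.
rewrite (reindex (@cons_sign m)) /=; last exact/onW_bij/cons_sign_bij.
rewrite (eq_bigr (fun p => F (cons_sign (p.1, p.2)))) => [|[]//].
rewrite -(pair_bigA _ (fun b e => F (cons_sign (b, e)))) /=.
by rewrite big_bool /= mulrC -big_split.
Qed.

Lemma sign_normE m (s y : 'I_m -> R) (x : R) :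
  (forall i, y i ^+ 2 = s i) ->
  (sign_norm s).[x] = \prod_(e : {ffun 'I_m -> bool}) (x - signed_sum e y).
Proof.
elim: m s y x => [|m IH] s y x ys.
  rewrite (big_pred1 [ffun i => false]) => [|e].
    by rewrite /signed_sum big_ord0 hornerX subr0.
  by apply/esym/eqP/ffunP => -[].
rewrite /= -ys pair_normE hornerM !horner_comp !hornerE.
rewrite !(IH _ (fun i => y (lift ord0 i))) // -big_split big_cons_sign /=.
by apply: eq_bigr => e _; rewrite !signed_sum_cons /=; ring.
Qed.

End SignNorm.

Lemma rmorph_signed_sum (R S : comNzRingType) (f : {rmorphism R -> S}) m
    (e : {ffun 'I_m -> bool}) (y : 'I_m -> R) :
  f (signed_sum e y) = signed_sum e (fun i => f (y i)).
Proof.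
by rewrite rmorph_sum; apply: eq_bigr => i _; rewrite rmorphM rmorph_sign.
Qed.

Lemma rmorph_sign_norm (R S : comNzRingType) (f : {rmorphism R -> S}) m
    (s : 'I_m -> R) :
  map_poly f (sign_norm s) = sign_norm (fun i => f (s i)).
Proof.
elim: m s => [|m IH] s /=; first by rewrite map_polyX.
rewrite -IH /pair_norm; set F := sign_norm _.
have mapG : map_poly (map_poly f) (F^:P \Po ('X + 'X%:P)) =
            (map_poly f F)^:P \Po ('X + 'X%:P).
  rewrite map_comp_poly rmorphD /= map_polyX map_polyC /= map_polyX.
  congr (_ \Po _); rewrite -!map_poly_comp; apply: eq_map_poly => c /=.
  by rewrite map_polyC.
have mapE (p : {poly {poly R}}) :
    map_poly (map_poly f) (even_poly p) = even_poly (map_poly (map_poly f) p).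
  by apply/polyP=> i; rewrite !(coef_map, coef_even_poly).
have mapO (p : {poly {poly R}}) :
    map_poly (map_poly f) (odd_poly p) = odd_poly (map_poly (map_poly f) p).
  by apply/polyP=> i; rewrite !(coef_map, coef_odd_poly).
rewrite -mapG -mapE -mapO rmorphB rmorphXn rmorphM rmorphXn /= -!horner_map /=.
by rewrite map_polyC.
Qed.

(** Used to replace the entries of [s] by perfect squares modulo a power of a
    variable.  Inserting a new variable in front of [r] gives a polynomial in it,
    and a polynomial is congruent to its constant term. *)
Lemma sign_norm_congr (R : comNzRingType) m (s r : 'I_m -> R) (e x : R) :
  exists h, (sign_norm (fun i => s i + e * r i)).[x] = (sign_norm s).[x] + e * h.
Proof.
pose G := (sign_norm (fun i => (s i)%:P + 'X * (r i)%:P)).[x%:P].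
have evG c : G.[c] = (sign_norm (fun i => s i + c * r i)).[x].
  rewrite -[in RHS](hornerC x c) -[LHS]/(horner_eval c G) /G -horner_map /=.
  rewrite rmorph_sign_norm; congr (_.[_]).
  apply: (f_equal (@sign_norm R m)); apply: functional_extensionality_dep => i /=.
  by rewrite /horner_eval !hornerE.
have s0 : (sign_norm s).[x] = G.[0].
  rewrite evG; congr (_.[_]); apply: (f_equal (@sign_norm R m)).
  by apply: functional_extensionality_dep => i; rewrite mul0r addr0.
exists (drop_poly 1 G).[e]; rewrite s0 -evG.
rewrite -{1}(poly_take_drop 1 G) !hornerE mulrC; congr (_ + _).
rewrite (_ : take_poly 1 G = (G.[0])%:P) ?hornerC //.
by apply/polyP=> i; rewrite coef_take_poly coefC horner_coef0; case: i.
Qed.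

(** * Sign products along a line *)

Lemma poly_nonroot (K : numDomainType) (p : {poly K}) :
  p != 0 -> exists x, p.[x] != 0.
Proof.
move=> p0; pose rs : seq K := [seq i%:R | i <- iota 0 (size p)].
have [/allPn[x _ nx]|] := boolP (~~ all (root p) rs); first by exists x.
rewrite negbK => /roots_geq_poly_eq0 rs0; case/eqP: p0; apply: rs0.
  by rewrite map_inj_uniq ?iota_uniq // => i j /eqP; rewrite eqr_nat => /eqP.
by rewrite size_map size_iota.
Qed.

Lemma poly_eq_off0 (K : numDomainType) (p q : {poly K}) :
  (forall t, t != 0 -> p.[t] = q.[t]) -> p = q.
Proof.
move=> pq; apply/eqP; rewrite -subr_eq0; apply/contraT=> pq0.
have /poly_nonroot[x] : (p - q) * 'X != 0 by rewrite mulf_neq0 ?polyX_eq0.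
by have [->|/pq xpq] := eqVneq x 0; rewrite !hornerE ?mulr0 ?xpq ?subrr ?mul0r eqxx.
Qed.

(** Controls a degree by the substitution [s = t ^- 2]: if it becomes polynomial in
    [t] after multiplication by [t ^+ N.*2], no coefficient beyond index [N] can be
    nonzero, since it would have to be the value at 0 of a multiple of [t]. *)
Lemma size_coef_inverted (K : numFieldType) (p q : {poly K}) N :
  (forall t, t != 0 -> q.[t] = t ^+ N.*2 * p.[t ^- 2]) ->
  (size p <= N.+1)%N /\ p`_N = q.[0].
Proof.
move=> pq.
have rev k : (size p <= (N + k).+1)%N -> p`_(N + k) = ('X^(k.*2) * q).[0].
  move=> szp; pose H := \sum_(i < (N + k).+1) p`_i *: 'X^((N + k - i).*2).
  have <- : H = 'X^(k.*2) * q.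
    apply: poly_eq_off0 => t t0; rewrite horner_sum hornerM hornerXn pq //.
    rewrite mulrA -exprD -doubleD [(k + N)%N]addnC (horner_coef_wide _ szp) mulr_sumr.
    apply: eq_bigr => i _; rewrite hornerZ hornerXn mulrCA; congr (_ * _).
    have: (i <= N + k)%N by rewrite -ltnS.
    move/subnK => /(congr1 double); rewrite doubleD => <-; rewrite exprD -mulrA.
    by rewrite -exprVn -exprM mul2n exprVn divff ?mulr1 // expf_neq0.
  rewrite horner_sum big_ord_recr /= subnn big1 ?add0r => [|i _].
    by rewrite hornerZ hornerXn mulr1.
  rewrite hornerZ hornerXn expr0n double_eq0 subn_eq0 leqNgt ltn_ord mulr0 //.
have szp k : (size p <= (N + k).+1)%N -> (size p <= N.+1)%N.
  elim: k => [|k IH] szp; first by rewrite addn0 in szp.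
  apply: IH; rewrite addnS in szp; apply/leq_sizeP => j.
  rewrite leq_eqVlt => /predU1P[<-|/(leq_trans szp)]; last exact: nth_default.
  by rewrite -addnS rev ?addnS // hornerM hornerXn expr0n mul0r.
have {}szp : (size p <= N.+1)%N by apply: (szp (size p)); rewrite leqW ?leq_addl.
by split; rewrite // -[N in p`_N]addn0 rev ?addn0 // expr0 mul1r.
Qed.

(** The mask [a] is meant to be 0/1-valued: together with [d i = 0] a zero of [a]
    removes the [i]-th square root from the sums. *)
Definition line_norm (R : comNzRingType) m (a d : 'I_m -> R) (c : R) : {poly R} :=
  (sign_norm (fun i => (a i)%:P - d i *: 'X)).[c%:P].

Lemma rmorph_line_norm (R S : comNzRingType) (f : {rmorphism R -> S}) m
    (a d : 'I_m -> R) (c : R) :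
  map_poly f (line_norm a d c) =
  line_norm (fun i => f (a i)) (fun i => f (d i)) (f c).
Proof.
rewrite /line_norm -[map_poly f _]horner_map /= rmorph_sign_norm /= map_polyC.
congr (_.[_]); congr sign_norm; apply: functional_extensionality_dep => i.
by rewrite rmorphB /= map_polyC map_polyZ map_polyX.
Qed.

Section SignNormPoly.
Variables (K : numClosedFieldType) (m : nat).
Implicit Types (a d y : 'I_m -> K) (c s : K).

Lemma line_normE a d c s y : (forall i, y i ^+ 2 = a i - d i * s) ->
  (line_norm a d c).[s] = \prod_(e : {ffun 'I_m -> bool}) (c - signed_sum e y).
Proof.
move=> ys; rewrite -[LHS]/(horner_eval s _) /line_norm -horner_map /=.
rewrite rmorph_sign_norm /= {2}/horner_eval hornerC; apply: sign_normE => i.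
by rewrite ys /horner_eval !hornerE.
Qed.

Lemma line_norm0 a d c s y : (forall i, y i ^+ 2 = a i - d i * s) ->
  \sum_i y i = c -> (line_norm a d c).[s] = 0.
Proof.
move=> ys yc; rewrite (line_normE c ys).
apply/eqP/prodf_eq0; exists [ffun=> false] => //; rewrite subr_eq0 -yc /signed_sum.
by apply/eqP/eq_bigr => i _; rewrite ffunE mul1r.
Qed.

Lemma line_norm_root a d c s : (line_norm a d c).[s] = 0 ->
  exists2 y, (forall i, y i ^+ 2 = a i - d i * s) & \sum_i y i = c.
Proof.
pose y i := sqrtC (a i - d i * s).
have ys i : y i ^+ 2 = a i - d i * s by rewrite sqrtCK.
rewrite (line_normE c ys) => /eqP/prodf_eq0[e _]; rewrite subr_eq0 => /eqP ->.
by exists (fun i => (-1) ^+ e i * y i) => // i; rewrite exprMn sqrr_sign mul1r.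
Qed.

(** The degree in [s] is at most half of the number of factors; after the substitution
    [s = t ^- 2] the square roots are those of [a i * t ^+ 2 - d i], divided by [t]. *)
Lemma line_norm_top a d c : (0 < m)%N ->
  (size (line_norm a d c) <= (2 ^ m.-1).+1)%N /\
  (line_norm a d c)`_(2 ^ m.-1) = (sign_norm (fun i => - d i)).[0].
Proof.
move=> m0; pose q := (sign_norm (fun i => a i *: 'X^2 - (d i)%:P)).[c *: 'X].
have qE t : q.[t] = (sign_norm (fun i => a i * t ^+ 2 - d i)).[c * t].
  rewrite -[LHS]/(horner_eval t _) /q -horner_map /= rmorph_sign_norm /=.
  rewrite {2}/horner_eval !hornerE; congr (_.[_]); congr sign_norm.
  by apply: functional_extensionality_dep => i; rewrite /horner_eval !hornerE.
have q0 : q.[0] = (sign_norm (fun i => - d i)).[0].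
  rewrite qE mulr0; congr (_.[_]); congr sign_norm.
  by apply: functional_extensionality_dep => i; rewrite expr0n mulr0 sub0r.
rewrite -q0; apply: size_coef_inverted => t t0.
pose y i := sqrtC (a i - d i * t ^- 2).
have ys i : y i ^+ 2 = a i - d i * t ^- 2 by rewrite sqrtCK.
rewrite qE (line_normE c ys) (@sign_normE _ _ _ (fun i => t * y i)); last first.
  by move=> i; rewrite exprMn ys; field.
rewrite -mul2n -expnS prednK //.
have -> : t ^+ (2 ^ m) = \prod_(e : {ffun 'I_m -> bool}) t.
  by rewrite prodr_const card_ffun card_bool card_ord.
rewrite -big_split; apply: eq_bigr => e _ /=; rewrite mulrBr mulrC; congr (_ - _).
by rewrite /signed_sum mulr_sumr; apply: eq_bigr => i _; rewrite mulrCA.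
Qed.

End SignNormPoly.

(** * The eliminant of the beta model on a complete graph *)

(** Newton iteration for the square root of [1 - c s] as a power series. *)
Lemma truncated_sqrt (K : numFieldType) (c : K) N :
  exists y : {poly K}, y`_0 = 1 /\
    exists r, y ^+ 2 = 1 - c *: 'X + 'X^(N.+1) * r.
Proof.
elim: N => [|N [y [y0 [r yr]]]].
  by exists 1; rewrite coef1; split=> //; exists c%:P; rewrite -mul_polyC; ring.
exists (y - (r`_0 / 2) *: 'X^(N.+1)); rewrite coefB coefZ coefXn y0 mulr0 subr0.
split=> //; pose b := r`_0.
have : (r - b *: y)`_0 = 0 by rewrite coefB coefZ y0 mulr1 subrr.
rewrite -horner_coef0 => /eqP/factor_theorem[h]; rewrite subr0 => rh.
exists (h + (b / 2) ^+ 2 *: 'X^N).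
have b2 : b%:P = (b / 2)%:P *+ 2.
  by rewrite -polyCMn -(mulr_natr (b / 2)) divfK ?pnatr_eq0.
move: rh; rewrite -!mul_polyC b2 polyC_exp => rh.
rewrite sqrrB yr [in RHS]exprS mulrDr.
rewrite -/b; move: (b / 2) rh => q rh.
have -> : r = h * 'X + q%:P *+ 2 * y by rewrite -rh subrK.
by rewrite -mul_polyC !exprS; ring.
Qed.

Section EliminationPoly.
Variable m : nat.

(** The eliminant: [s] is a root iff some choice of the roots of the
    [1 - d i * s] sums to [2 - m]. *)
Definition elim_poly (R : comNzRingType) (d : 'I_m -> R) : {poly R} :=
  line_norm (fun=> 1) d (2 - m%:R).

Lemma rmorph_elim_poly (R S : comNzRingType) (f : {rmorphism R -> S}) d :
  map_poly f (elim_poly d) = elim_poly (fun i => f (d i)).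
Proof.
by rewrite /elim_poly rmorph_line_norm rmorphB !rmorph_nat; congr line_norm;
   apply: functional_extensionality_dep => i; rewrite rmorph1.
Qed.

Definition lone_plus (i : 'I_m) : {ffun 'I_m -> bool} := [ffun j => j != i].

Lemma lone_plus_inj : injective lone_plus.
Proof.
by move=> i j /ffunP/(_ i); rewrite !ffunE eqxx => /esym/negbFE/eqP.
Qed.

Lemma signed_sum_lone_plus (R : comNzRingType) (y : 'I_m -> R) i :
  signed_sum (lone_plus i) y = y i *+ 2 - \sum_j y j.
Proof.
rewrite /signed_sum (bigD1 i) //= ffunE eqxx mul1r [in RHS](bigD1 i) //=.
rewrite mulr2n opprD addrA addrK; congr (_ + _); rewrite -sumrN.
by apply: eq_bigr => j ji; rewrite ffunE ji mulN1r.
Qed.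

Lemma lone_plusP (e : {ffun 'I_m -> bool}) :
  (e \in codom lone_plus) = (#|[set i | ~~ e i]| == 1%N).
Proof.
apply/codomP/cards1P; case=> i.
  by move=> ->; exists i; apply/setP=> j; rewrite !inE ffunE negbK.
move=> /setP ei; exists i; apply/ffunP=> j; have := ei j.
by rewrite !inE ffunE => <-; rewrite negbK.
Qed.

Variable K : numClosedFieldType.
Implicit Type d : 'I_m -> K.

Lemma signed_sum_ones e : 
  (2 - m%:R - signed_sum e (fun=> 1) == 0 :> K) = (e \in codom lone_plus).
Proof.
rewrite lone_plusP; set A := [set i | ~~ e i].
have -> : signed_sum e (fun=> 1) = #|A|%:R *+ 2 - m%:R :> K.
  rewrite -[in m%:R](card_ord m) -(cardsC A) natrD mulr2n opprD addrA addrK.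
  rewrite /signed_sum (bigID (mem A)) /=; congr (_ + _).
    rewrite (eq_bigr (fun=> 1)) ?sumr_const // => i.
    by rewrite inE => /negbTE->; rewrite mulr1.
  rewrite (eq_bigr (fun=> -1)) => [|i]; last first.
    by rewrite inE negbK => ->; rewrite mulr1.
  by rewrite sumrN -sumr_const; congr (- _); apply: eq_bigl => i; rewrite !inE.
rewrite opprB addrA subrK subr_eq0 -(mulrnA 1) eqr_nat eq_sym.
by rewrite -[X in _ == X]mul1n eqn_pmul2r.
Qed.

(** At [s = 0] the factor of a sign pattern with [q] plus signs is [2 - 2 q]: the
    vanishing ones are the patterns with a single plus sign, say at [i], and the
    linear term of such a factor is half of [d i - \sum_(j | j != i) d j].  The
    power series roots are truncated after degree [m], which leaves the
    coefficient of ['X^m] unchanged. *)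
Lemma elim_poly_order d : exists2 h : {poly K}, elim_poly d = 'X^m * h &
  (forall i, d i != \sum_(j | j != i) d j) -> h.[0] != 0.
Proof.
have /fin_all_exists[y /all_and2[y0 /fin_all_exists[r yr]]] i :=
  truncated_sqrt (d i) m.
pose F e : {poly K} := (2 - m%:R)%:P - signed_sum e y.
have F0 e : (F e).[0] = 2 - m%:R - signed_sum e (fun=> 1).
  rewrite hornerD hornerN hornerC -[X in _ - X]/(horner_eval 0 _) rmorph_signed_sum.
  congr (_ - _); apply: eq_bigr => i _; congr (_ * _).
  by rewrite /= /horner_eval horner_coef0.
have y1 (i j : 'I_m) : (y j)`_1 *+ 2 = - d j.
  move/polyP/(_ 1%N): (yr j).
  rewrite coefD coefXnM coefB coef1 coefZ coefX /= mulr1 sub0r.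
  case: (m) i => [[]//|m' _]; rewrite addr0 => <-.
  by rewrite coefM !big_ord_recl big_ord0 /= !y0 mul1r mulr1 addr0 mulr2n.
pose Q e := drop_poly 1 (F e).
have FQ i : F (lone_plus i) = 'X * Q (lone_plus i).
  rewrite -{1}(poly_take_drop 1 (F _)) mulrC -[RHS]add0r; congr (_ + _).
  apply/polyP=> -[|k]; rewrite coef_take_poly coef0 //= -horner_coef0 F0.
  by apply/eqP; rewrite signed_sum_ones codom_f.
have Q0 i : (Q (lone_plus i)).[0] *+ 2 = d i - \sum_(j | j != i) d j.
  rewrite horner_coef0 coef_drop_poly coefB coefC sub0r signed_sum_lone_plus.
  rewrite coefB coefMn coef_sum opprB mulrnBl -sumrMnl.
  rewrite (eq_bigr (fun j => - d j)) => [|j _]; last exact: (y1 i).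
  by rewrite (y1 i) sumrN [in LHS](bigD1 i) //= mulNrn; ring.
pose H := \prod_i Q (lone_plus i) * \prod_(e | e \notin codom lone_plus) F e.
have prodF : \prod_e F e = 'X^m * H.
  rewrite (bigID (mem (codom lone_plus))) /=.
  rewrite -big_uniq ?map_inj_uniq -?enumT ?enum_uniq //=; last exact: lone_plus_inj.
  rewrite big_image /= (eq_bigr _ (fun i _ => FQ i)) big_split /= prodr_const.
  by rewrite card_ord mulrA.
have [g] := sign_norm_congr (fun i => 1 - d i *: 'X) r 'X^(m.+1) (2 - m%:R)%:P.
rewrite (sign_normE _ yr).
rewrite -/(line_norm (fun=> 1) d _) => FE.
exists (H - 'X * g).
  by rewrite mulrBr -prodF FE exprSr mulrA addrK.
move=> d0; rewrite hornerD hornerN !hornerM hornerX mul0r subr0 !horner_prod.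
apply/mulf_neq0.
  apply/prodf_neq0 => i _; apply: contra (d0 i) => /eqP Qi.
  by rewrite -subr_eq0 -Q0 Qi mul0rn.
by apply/prodf_neq0 => e eN; rewrite F0 signed_sum_ones.
Qed.

(** To first order at [s] the square roots are polynomials, because they do not
    vanish.  The two sign patterns given by [y] and [z] then contribute two
    factors divisible by the local parameter. *)
Lemma elim_poly_double_root d s (y z : 'I_m -> K) :
  (forall i, y i ^+ 2 = 1 - d i * s) -> (forall i, z i ^+ 2 = 1 - d i * s) ->
  (forall i, y i != 0) -> \sum_i y i = 2 - m%:R -> \sum_i z i = 2 - m%:R ->
  (exists i, y i != z i) ->
  root (elim_poly d)^`() s.
Proof.
move=> ys zs y0 yk zk [i0 yz].
(* [b i] is the derivative at [s] of the branch of the square root through [y i]. *)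
pose b i := - d i / (2 * y i).
pose w i : {poly K} := (y i)%:P + b i *: 'X.
have ws i : w i ^+ 2 = (1 - (d i) *: ('X + s%:P)) + 'X^2 * (b i ^+ 2)%:P.
  rewrite /w -!mul_polyC sqrrD -polyC_exp ys polyCB polyCM polyC1.
  have -> : (d i)%:P = - (2 * y i * b i)%:P :> {poly K}.
    by rewrite -polyCN; congr (_%:P); rewrite /b; field; rewrite y0.
  by rewrite polyC_exp !polyCM polyC_natr; ring.
have EQ : elim_poly d \Po ('X + s%:P) =
    (sign_norm (fun i => 1 - (d i) *: ('X + s%:P))).[(2 - m%:R)%:P].
  rewrite /elim_poly /line_norm -[LHS]/(comp_poly _ _) -horner_map /=.
  rewrite rmorph_sign_norm /= comp_polyC; congr (_.[_]); congr sign_norm.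
  apply: functional_extensionality_dep => i.
  by rewrite comp_polyB comp_polyC comp_polyZ comp_polyX.
have [g] := sign_norm_congr (fun i => 1 - (d i) *: ('X + s%:P))
  (fun i => (b i ^+ 2)%:P) 'X^2 (2 - m%:R)%:P.
rewrite -EQ (sign_normE _ ws) (bigD1 [ffun=> false]) //=.
pose e := [ffun i => y i != z i].
have eN : e != [ffun=> false].
  by apply/negP=> /eqP/ffunP/(_ i0); rewrite !ffunE yz.
have zE i : z i = (-1) ^+ e i * y i.
  rewrite ffunE; have [->|yzi] := eqVneq; rewrite ?mul1r //= mulN1r.
  by move/eqP: (ys i); rewrite -zs eqf_sqr (negbTE yzi) /= => /eqP->; rewrite opprK.
rewrite (bigD1 e) //= mulrA.
have div_f (f : {ffun 'I_m -> bool}) : \sum_i (-1) ^+ f i * y i = 2 - m%:R ->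
    exists g, (2 - m%:R)%:P - signed_sum f w = 'X * g.
  move=> fk; have /factor_theorem[h hE] : root ((2 - m%:R)%:P - signed_sum f w) 0.
    rewrite /root -[X in X == _]/(horner_eval 0 _) rmorphB rmorph_signed_sum /=.
    rewrite /horner_eval hornerC -fk subr_eq0; apply/eqP/eq_bigr => i _.
    by rewrite /w !hornerE ?mulr0 ?addr0.
  by exists h; rewrite hE subr0 mulrC.
have [g1 ->] : exists g, (2 - m%:R)%:P - signed_sum [ffun=> false] w = 'X * g.
  by apply: div_f; rewrite -yk; apply: eq_bigr => i _; rewrite ffunE mul1r.
have [g2 ->] := div_f e (etrans (esym (eq_bigr _ (fun i _ => zE i))) zk).
set P := \prod_(_ | _) _ => E.
have /(congr1 (fun p => (deriv p).[0])) :
    elim_poly d \Po ('X + s%:P) = 'X^2 * (g1 * g2 * P - g).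
  by rewrite -[LHS](addrK ('X^2 * g)) -E; ring.
rewrite deriv_comp derivD derivX derivC addr0 mulr1 horner_comp !hornerE.
rewrite derivM derivXn hornerD !hornerM hornerMn !hornerXn expr0n.
by rewrite !(mul0r, mul0rn) addr0 => /eqP.
Qed.
End EliminationPoly.

(** * Properties that hold generically *)

(** The leading monomial [m0] of [p] is the only one that contributes to the
    coefficient of [muni p] at the exponents of [m0]. *)
Lemma muni_neq0 (R : nzRingType) n (p : {mpoly R[n.+1]}) : p != 0 -> muni p != 0.
Proof.
move=> /mlead_supp lp; set m0 := mlead p in lp.
pose tl (m : 'X_{1..n.+1}) := [multinom m (widen_ord (leqnSn n) i) | i < n].
apply: contraTneq (lp) => pE; rewrite -mcoeff_eq0.
have <- : (muni p)`_(m0 ord_max) @_ (tl m0) = p@_m0; last by rewrite pE coef0 mcoeff0.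
rewrite muniE coef_sum raddf_sum /= (bigD1_seq m0) //= big1 ?addr0 => [|m mm0].
  by rewrite coefZ coefXn eqxx mulr1 mcoeffZ mcoeffX eqxx mulr1.
rewrite coefZ coefXn; have [mk|] := eqVneq; last by rewrite mulr0 mcoeff0.
rewrite mulr1 mcoeffZ mcoeffX; have [mt|] := eqVneq; last by rewrite mulr0.
case/eqP: mm0; apply/mnmP => i; have [j ->|->] := unliftP ord_max i; last by rewrite mk.
have := congr1 (fun f : 'X_{1..n} => f j) mt; rewrite !mnmE.
by rewrite (_ : widen_ord _ _ = lift ord_max j) //; apply/val_inj/esym/lift_max.
Qed.

Lemma meval_muni (R : comNzRingType) n (p : {mpoly R[n.+1]}) (v : 'I_n.+1 -> R) :
  (map_poly (meval (fun i => v (lift ord_max i))) (muni p)).[v ord_max] = p.@[v].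
Proof.
rewrite muniE mevalE rmorph_sum horner_sum /=; apply: eq_bigr => m _.
rewrite map_polyZ map_polyXn /= hornerZ hornerXn mevalZ mevalX -mulrA; congr (_ * _).
rewrite big_ord_recr /=; congr (_ * _); apply: eq_bigr => i _; rewrite mnmE.
by rewrite (_ : widen_ord _ _ = lift ord_max i) //; apply/val_inj/esym/lift_max.
Qed.

Lemma mpoly_nonroot (K : numFieldType) m (p : {mpoly K[m]}) :
  p != 0 -> exists d, p.@[d] != 0.
Proof.
elim: m p => [|m IH] p p0.
  exists (fun=> 0); move: p0; rewrite (nvar0_mpolyC p) mevalC.
  by apply: contraNneq => ->; rewrite mpolyC0.
have /IH[d dl] : lead_coef (muni p) != 0 by rewrite lead_coef_eq0 muni_neq0.
have /poly_nonroot[x xp] : map_poly (meval d) (muni p) != 0.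
  by apply: contraNneq dl => p0'; rewrite lead_coefE -coef_map p0' coef0.
exists (fun i => if unlift ord_max i is Some j then d j else x).
rewrite -meval_muni unlift_none (_ : (fun i => _) = d) //.
by apply: functional_extensionality_dep => i; rewrite liftK.
Qed.

Section Generic.
Variable K : numFieldType.

(** Genericity on functions rather than on column vectors: this is the form in
    which evaluations of multivariate polynomials appear. *)
Definition generic m (P : ('I_m -> K) -> Prop) :=
  exists2 g : {mpoly K[m]}, g != 0 & forall d, g.@[d] != 0 -> P d.

Lemma generic_neq0 m (g : {mpoly K[m]}) :
  (exists d, g.@[d] != 0) -> generic (fun d => g.@[d] != 0).
Proof. by case=> d dg; exists g => //; apply: contraNneq dg => ->; rewrite meval0. Qed.

Lemma generic_nonempty m P : generic P -> exists d : 'I_m -> K, P d.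
Proof. by case=> g /mpoly_nonroot[d dg] gP; exists d; apply: gP. Qed.

Lemma generic_imp m (P Q : ('I_m -> K) -> Prop) :
  (forall d, P d -> Q d) -> generic P -> generic Q.
Proof. by move=> PQ [g g0 gP]; exists g => // d /gP/PQ. Qed.

Lemma generic_and m (P Q : ('I_m -> K) -> Prop) :
  generic P -> generic Q -> generic (fun d => P d /\ Q d).
Proof.
move=> [g g0 gP] [h h0 hQ]; exists (g * h); first by rewrite mulf_neq0.
by move=> d; rewrite mevalM mulf_eq0 negb_or => /andP[/gP ? /hQ ?].
Qed.

Lemma generic_forall m (I : finType) (P : I -> ('I_m -> K) -> Prop) :
  (forall i, generic (P i)) -> generic (fun d => forall i, P i d).
Proof.
move=> /fin_all_exists2[g g0 gP].
exists (\prod_i g i) => [|d]; first by apply/prodf_neq0.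
by rewrite rmorph_prod => /prodf_neq0 gd i; apply/gP/gd.
Qed.

(** Genericity in the image of a polynomial map pulls back when the map is onto. *)
Lemma generic_comp m m' (L : 'I_m -> {mpoly K[m']}) P :
  (forall d, exists u, forall i, (L i).@[u] = d i) ->
  generic P -> generic (fun u => P (fun i => (L i).@[u])).
Proof.
move=> Lsurj [g /mpoly_nonroot[d dg] gP].
have gL u : (g \mPo [tuple L i | i < m]).@[u] = g.@[fun i => (L i).@[u]].
  by rewrite comp_mpoly_meval; apply: meval_eq => i; rewrite tnth_mktuple.
have [u ud] := Lsurj d.
exists (g \mPo [tuple L i | i < m]) => [|v]; last by rewrite gL => /gP.
apply: contraNneq dg => g0; have := gL u; rewrite g0 meval0 => ->.
by apply/eqP/meval_eq.
Qed.

End Generic.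

(** * The generic conditions on the degrees *)

Section GenericConditions.
Variables (K : numClosedFieldType) (m : nat).

(** No signed sum of square roots of the [- d i] over a nonempty [U] vanishes.  The
    value at 0 of the sign product is the product of all these sums, up to sign,
    and by [line_norm_top] it is the leading coefficient of the polynomials
    attached to [U]. *)
Definition no_signed_sum (d : 'I_m -> K) :=
  forall U : {set 'I_m}, U != set0 ->
    (sign_norm (fun i => - (if i \in U then d i else 0))).[0] != 0.

Lemma no_signed_sum_generic : generic no_signed_sum.
Proof.
apply: generic_forall => U; have [->|[i0 i0U]] := set_0Vmem U.
  by exists 1; rewrite ?oner_neq0 ?eqxx.
pose g : {mpoly K[m]} := (sign_norm (fun i => - (if i \in U then 'X_i else 0))).[0].
have gE d : g.@[d] = (sign_norm (fun i => - (if i \in U then d i else 0))).[0].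
  rewrite /g -[_.@[d]]horner_map rmorph_sign_norm /= meval0; congr (_.[_]).
  congr sign_norm; apply: functional_extensionality_dep => i.
  by rewrite mevalN; case: ifP; rewrite ?mevalXU ?meval0.
have [h h0 hg] : generic (fun d => g.@[d] != 0).
  apply: generic_neq0; exists (fun i => - (i == i0)%:R).
  rewrite gE (@sign_normE _ _ _ (fun i => (i == i0)%:R)) => [|i]; last first.
    have [->|] := eqVneq; first by rewrite i0U opprK expr1n.
    by case: ifP; rewrite expr0n oppr0 ?oppr0.
  apply/prodf_neq0 => e _; rewrite sub0r oppr_eq0 /signed_sum (bigD1 i0) //=.
  rewrite eqxx mulr1 big1 ?addr0 ?signr_eq0 // => i /negbTE->.
  by rewrite mulr0.
by exists h => // d /hg; rewrite gE.
Qed.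

(** If [d i] were the sum of the other degrees, a star centred at [i] would be a
    solution with vanishing weights. *)
Lemma unbalanced_generic :
  generic (fun d : 'I_m -> K => forall i, d i != \sum_(j | j != i) d j).
Proof.
apply: generic_forall => i.
pose g : {mpoly K[m]} := 'X_i - \sum_(j | j != i) 'X_j.
have gE d : g.@[d] = d i - \sum_(j | j != i) d j.
  rewrite mevalB mevalXU; congr (_ - _); rewrite raddf_sum /=.
  by apply: eq_bigr => j _; rewrite mevalXU.
have [h h0 hg] : generic (fun d => g.@[d] != 0).
  apply: generic_neq0; exists (fun j => (j == i)%:R); rewrite gE eqxx.
  by rewrite big1 ?subr0 ?oner_neq0 // => j /negbTE->.
by exists h => // d /hg; rewrite gE subr_eq0.
Qed.

Lemma nonzero_generic : generic (fun d : 'I_m -> K => forall i, d i != 0).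
Proof.
apply: generic_forall => i.
have [h h0 hg] : generic (fun d : 'I_m -> K => ('X_i).@[d] != 0).
  by apply: generic_neq0; exists (fun=> 1); rewrite mevalXU oner_neq0.
by exists h => // d /hg; rewrite mevalXU.
Qed.

Lemma elim_poly_meval (d : 'I_m -> K) :
  map_poly (meval d) (elim_poly (fun i => 'X_i)) = elim_poly d.
Proof.
rewrite rmorph_elim_poly; congr elim_poly.
by apply: functional_extensionality_dep => i /=; rewrite mevalXU.
Qed.

Lemma two_sub_neq0 : (2 < m)%N -> 2 - m%:R != 0 :> K.
Proof. by move=> m2; rewrite subr_eq0 eqr_nat ltn_eqF. Qed.

(** Excludes solutions with [y i = 0], where the square root branches.  The
    condition is cleared of denominators to a polynomial in [d]; it holds at
    [d = 1], where all square roots vanish at [s = 1]. *)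
Lemma no_branch_generic : (2 < m)%N ->
  generic (fun d : 'I_m -> K => forall i, (elim_poly d).[(d i)^-1] != 0).
Proof.
move=> m2; apply: generic_forall => i.
pose E : {poly {mpoly K[m]}} := elim_poly (fun i => 'X_i).
pose g : {mpoly K[m]} := \sum_(k < size E) E`_k * 'X_i ^+ (size E - k).
have gE d : d i != 0 -> g.@[d] = d i ^+ size E * (elim_poly d).[(d i)^-1].
  move=> di; rewrite (@horner_coef_wide _ (size E)); last first.
    by rewrite -elim_poly_meval size_poly.
  rewrite raddf_sum mulr_sumr; apply: eq_bigr => k _ /=.
  rewrite mevalM -elim_poly_meval coef_map /= rmorphXn /= mevalXU mulrCA.
  by rewrite expfB_cond ?(negbTE di) ?add0n ?exprVn // ltnW.
have [h h0 hg] : generic (fun d => g.@[d] != 0 /\ forall i, d i != 0).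
  apply: generic_and (nonzero_generic); apply: generic_neq0.
  exists (fun=> 1); rewrite gE ?oner_neq0 // expr1n mul1r invr1.
  rewrite (@line_normE _ _ _ _ _ _ (fun=> 0)) => [|j]; last by rewrite expr0n mulr1 subrr.
  apply/prodf_neq0 => e _; rewrite /signed_sum big1 ?subr0 ?two_sub_neq0 // => j _.
  by rewrite mulr0.
by exists h => // d /hg[gd d0]; apply: contraNneq gd => E0; rewrite gE // E0 mulr0.
Qed.

End GenericConditions.

(** * Double roots and coinciding branches *)

Lemma mpoly_deriv_neq0 (K : numFieldType) m (p : {poly {mpoly K[m]}}) :
  (1 < size p)%N -> p^`() != 0.
Proof.
move=> sz; have p0 : p != 0 by rewrite -size_poly_gt0 ltnW.
apply: contraTneq isT => /polyP/(_ (size p).-2).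
rewrite coef_deriv coef0 => /mpolyP lp0; case/negP: p0; rewrite -lead_coef_eq0.
apply/eqP/mpolyP => mn; have := lp0 mn; rewrite mcoeffMn mcoeff0 => /eqP.
by rewrite mulrn_eq0 /= lead_coefE; case: (size p) sz => [|[|k]] //= _ /eqP.
Qed.

(** In characteristic 0 the only obstruction to separability is a repeated factor,
    here up to a scalar since the coefficients do not form a field. *)
Lemma nonseparable_square (K : numFieldType) m (p : {poly {mpoly K[m]}}) :
  p != 0 -> ~~ separable_poly p ->
  exists (c : {mpoly K[m]}) (A B : {poly {mpoly K[m]}}),
    [/\ c != 0, (1 < size A)%N & c *: p = A ^+ 2 * B].
Proof.
move=> p0 /separable_polyP nsep; apply: contrapT => noA; apply: nsep.
split=> [u v uvp|u _ szu]; last exact: mpoly_deriv_neq0.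
apply/negPn/negP => ncop; apply: noA; pose A := gcdp u v.
have : A * A %| p.
  by apply: dvdp_trans uvp; apply: dvdp_mul; [exact: dvdp_gcdl|exact: dvdp_gcdr].
case/Pdiv.Idomain.dvdpP => -[c q] /= c0 /= cE.
exists c, A, q; split=> //; last by rewrite cE expr2 mulrC.
rewrite ltn_neqAle eq_sym ncop size_poly_gt0.
apply: contraNneq p0 => A0; move: cE; rewrite A0 mulr0 mulr0 => /eqP.
by rewrite -mul_polyC mulf_eq0 polyC_eq0 (negbTE c0).
Qed.

Lemma double_root_prod (K : fieldType) (I : finType) (L : I -> {poly K}) x :
  (forall i, size (L i) = 2%N) -> ('X - x%:P) ^+ 2 %| \prod_i L i ->
  exists i j, [/\ i != j, root (L i) x & root (L j) x].
Proof.
move=> szL dvL.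
have : root (\prod_i L i) x.
  by rewrite -dvdp_XsubCl; apply: dvdp_trans dvL; rewrite expr2 dvdp_mulIl.
rewrite /root horner_prod => /prodf_eq0[i _ Li]; exists i.
have /factor_theorem[q qL] : root (L i) x by [].
have q0 : q.[x] != 0.
  have q0 : q != 0 by apply: contra_eq_neq (szL i) => q0; rewrite qL q0 mul0r size_poly0.
  move/eqP: (szL i); rewrite qL size_Mmonic ?monicXsubC // size_XsubC addn2 /=.
  by rewrite !eqSS => /size_poly1P[c c0 ->]; rewrite hornerC.
move: dvL; rewrite (bigD1 i) //= qL expr2 -mulrA mulrCA dvdp_mul2l ?polyXsubC_eq0 //.
rewrite dvdp_XsubCl /root hornerM mulf_eq0 (negbTE q0) /= horner_prod.
case/prodf_eq0 => j ji Lj; exists j; split=> //; first by rewrite eq_sym.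
by rewrite /root -qL.
Qed.

Section Separability.
Variables (K : numClosedFieldType) (m' : nat).
Local Notation m := m'.+1.

(** The line in the space of degrees on which only the first one varies. *)
Definition move0 (d : 'I_m -> K) (t : K) : 'I_m -> K :=
  fun i => if i == ord0 then t else d i.

Lemma mmap_move0 (d : 'I_m -> K) (g : {mpoly K[m]}) t :
  (mmap polyC (fun i => if i == ord0 then 'X else (d i)%:P) g).[t] =
  g.@[move0 d t].
Proof.
rewrite /meval -[LHS]/(horner_eval t _) /mmap rmorph_sum; apply: eq_bigr => k _.
rewrite rmorphM /= /horner_eval hornerC /mmap1 horner_prod; congr (_ * _).
apply: eq_bigr => i _; rewrite horner_exp /move0.
by case: ifP; rewrite ?hornerX ?hornerC.
Qed.

(** Pairing the two signs of the root of [1 - t * s] makes the eliminant a product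
    of affine functions of [t]. *)
Lemma elim_poly_move0 d s (y : 'I_m' -> K) :
  (forall i, y i ^+ 2 = 1 - d (lift ord0 i) * s) ->
  forall t, (elim_poly (move0 d t)).[s] =
  (\prod_(e : {ffun 'I_m' -> bool})
     (s *: 'X + ((2 - m%:R - signed_sum e y) ^+ 2 - 1)%:P)).[t].
Proof.
move=> ys t; pose y0 := sqrtC (1 - t * s).
pose z (i : 'I_m) := if unlift ord0 i is Some j then y j else y0.
rewrite (@line_normE _ _ _ _ _ _ z) => [|i]; last first.
  rewrite /z /move0; case: unliftP => [j|] -> /=; last by rewrite sqrtCK.
  by rewrite ys.
rewrite big_cons_sign horner_prod; apply: eq_bigr => e _; rewrite !signed_sum_cons /=.
have -> : (fun i => z (lift ord0 i)) = y.
  by apply: functional_extensionality_dep => i; rewrite /z liftK.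
rewrite /z unlift_none hornerD hornerZ hornerX hornerC.
have : y0 ^+ 2 = 1 - t * s by rewrite sqrtCK.
move=> y0E; transitivity ((2 - m%:R - signed_sum e y) ^+ 2 - y0 ^+ 2); first by ring.
by rewrite y0E; ring.
Qed.

(** The values [s] at which some signed sum of the roots indexed by [V] is [c]. *)
Definition coincidence_poly (d : 'I_m -> K) (V : {set 'I_m}) (c : K) : {poly K} :=
  line_norm (fun i => (i \in V)%:R) (fun i => if i \in V then d i else 0) c.

Lemma coincidence_poly_neq0 d V c : no_signed_sum d -> V != set0 ->
  coincidence_poly d V c != 0.
Proof.
move=> dV V0; apply: contraTneq (dV V V0) => F0; rewrite negbK.
have [_ <-] := line_norm_top (fun i => (i \in V)%:R)
  (fun i => if i \in V then d i else 0) c (ltn0Sn m').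
by rewrite -/(coincidence_poly d V c) F0 coef0.
Qed.

(** If [e] and [e'] give the same square, then the two signed sums are equal, and
    the terms on which [e] and [e'] differ add up to 0; or they add up to
    [2 * (2 - m)], and the terms on which [e] and [e'] agree add up to [2 - m].
    There is at least one such term because [2 - m] is nonzero. *)
Lemma branch_coincidence (d : 'I_m -> K) s t (e e' : {ffun 'I_m' -> bool}) y :
  (2 < m)%N -> (forall i, y i ^+ 2 = 1 - d (lift ord0 i) * s) -> e != e' ->
  s * t + ((2 - m%:R - signed_sum e y) ^+ 2 - 1) = 0 ->
  s * t + ((2 - m%:R - signed_sum e' y) ^+ 2 - 1) = 0 ->
  exists2 V : {set 'I_m}, V != set0 &
    root (coincidence_poly d V 0 * coincidence_poly d V (2 - m%:R)) s.
Proof.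
move=> m2 ys ee' es e's.
have : (2 - m%:R - signed_sum e y) ^+ 2 == (2 - m%:R - signed_sum e' y) ^+ 2.
  by rewrite -subr_eq0 -(subrr (0 : K)) -{1}es -{1}e's; apply/eqP; ring.
have rootV (W : {set 'I_m'}) c :
    \sum_(i in W) (-1) ^+ e i * y i = c ->
    root (coincidence_poly d (lift ord0 @: W) c) s.
  move=> Wc; have inV (j : 'I_m') : (lift ord0 j \in lift ord0 @: W) = (j \in W).
    by rewrite mem_imset //; apply: lift_inj.
  have V0 : ord0 \notin lift ord0 @: W by apply/imsetP => -[].
  pose z (i : 'I_m) := if unlift ord0 i is Some j
                       then if j \in W then (-1) ^+ e j * y j else 0 else 0.
  apply/eqP/(line_norm0 (y := z)) => [i|].
    rewrite /z; case: unliftP => [j|] -> /=.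
      rewrite inV; case: ifP => _; last by rewrite mul0r subr0 expr0n.
      by rewrite exprMn sqrr_sign mul1r ys.
    by rewrite (negbTE V0) mul0r subr0 expr0n.
  rewrite big_ord_recl /z unlift_none add0r -Wc [RHS]big_mkcond /=.
  by apply: eq_bigr => i _; rewrite liftK.
have VP (W : {set 'I_m'}) : W != set0 -> lift ord0 @: W != set0 :> {set 'I_m}.
  by case/set0Pn => i iW; apply/set0Pn; exists (lift ord0 i); apply: imset_f.
rewrite eqf_sqr => /orP[]/eqP E.
  pose W := [set i | e i != e' i].
  have V0 : lift ord0 @: W != set0 :> {set 'I_m}.
    apply: VP; apply: contraNneq ee' => /setP W0; apply/eqP/ffunP => i.
    by have := W0 i; rewrite !inE => /negbFE/eqP.
  exists (lift ord0 @: W); rewrite // rootM rootV //.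
  have vE : signed_sum e y = signed_sum e' y by move/addrI/oppr_inj: E.
  have: (\sum_(i in W) (-1) ^+ e i * y i) *+ 2 = signed_sum e y - signed_sum e' y.
    rewrite /signed_sum -sumrB -sumrMnl [LHS]big_mkcond /=; apply: eq_bigr => i _.
    by rewrite inE; case: (e i) (e' i) => -[] /=; ring.
  by rewrite vE subrr => /eqP; rewrite mulrn_eq0 => /eqP.
pose W := [set i | e i == e' i].
have WE : \sum_(i in W) (-1) ^+ e i * y i = 2 - m%:R.
  have: (\sum_(i in W) (-1) ^+ e i * y i) *+ 2 = signed_sum e y + signed_sum e' y.
    rewrite /signed_sum -big_split -sumrMnl [LHS]big_mkcond /=; apply: eq_bigr => i _.
    by rewrite inE; case: (e i) (e' i) => -[] /=; ring.
  have -> : signed_sum e y + signed_sum e' y = (2 - m%:R) *+ 2.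
    by rewrite mulr2n -[in RHS](subrK (signed_sum e y) (2 - m%:R)) {1}E; ring.
  by move/eqP; rewrite -subr_eq0 -mulrnBl mulrn_eq0 /= subr_eq0 => /eqP.
have V0 : lift ord0 @: W != set0 :> {set 'I_m}.
  apply: VP; apply: contraTneq (two_sub_neq0 K m2) => W0; rewrite negbK -WE W0.
  by rewrite big_set0.
by exists (lift ord0 @: W); rewrite // rootM (rootV _ _ WE) orbT.
Qed.
End Separability.

(** * Generic simplicity of the roots of the eliminant *)

(** The root 0 is excluded: it has multiplicity [m]. *)
Definition simple_elim (K : fieldType) m (d : 'I_m -> K) :=
  forall s, s != 0 -> root (elim_poly d) s -> ~~ root (elim_poly d)^`() s.

Section SeparabilityTheorem.
Variables (K : numClosedFieldType) (m' : nat).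
Local Notation m := m'.+1.
Hypothesis m2 : (2 < m)%N.

Let E : {poly {mpoly K[m]}} := elim_poly (fun i => 'X_i).
Let T : {poly {mpoly K[m]}} := drop_poly m E.

Definition restrict_line (d : 'I_m -> K) : {rmorphism {mpoly K[m]} -> {poly K}} :=
  mmap polyC (fun i => if i == ord0 then 'X else (d i)%:P).

Lemma restrict_lineE d (f : {mpoly K[m]}) t :
  (restrict_line d f).[t] = f.@[move0 d t].
Proof. exact: mmap_move0. Qed.

Lemma map_restrict_lineE d (f : {poly {mpoly K[m]}}) s t :
  (map_poly (restrict_line d) f).[s%:P].[t] =
  (map_poly (meval (move0 d t)) f).[s].
Proof.
rewrite -[LHS]/(horner_eval t _) -horner_map -map_poly_comp /=.
rewrite {2}/horner_eval hornerC; congr (_.[_]); apply: eq_map_poly => g /=.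
exact: restrict_lineE.
Qed.

Lemma elim_poly_tail d : elim_poly d = 'X^m * map_poly (meval d) T.
Proof.
have [h dh _] := elim_poly_order d; rewrite dh; congr (_ * _).
apply/polyP=> i; rewrite coef_map coef_drop_poly /= -coef_map /= elim_poly_meval.
by rewrite dh coefXnM ltnNge leq_addl /= addnK.
Qed.

Lemma tail0_neq0 d : (forall i, d i != \sum_(j | j != i) d j) ->
  (map_poly (meval d) T).[0] != 0.
Proof.
move=> ub; have [h dh /(_ ub)] := elim_poly_order d; congr (_.[_] != _).
by apply/(@mulfI _ ('X^m)); rewrite ?expf_neq0 ?polyX_eq0 // -dh elim_poly_tail.
Qed.

(** The finite set depends on [d] through the degrees of index other than 0 only,
    so it serves the whole line of [move0 d]. *)
Lemma coincidence_roots (d : 'I_m -> K) : no_signed_sum d ->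
  exists rs : seq K, forall s t (e e' : {ffun 'I_m' -> bool}) y,
    (forall i, y i ^+ 2 = 1 - d (lift ord0 i) * s) -> e != e' ->
    s * t + ((2 - m%:R - signed_sum e y) ^+ 2 - 1) = 0 ->
    s * t + ((2 - m%:R - signed_sum e' y) ^+ 2 - 1) = 0 -> s \in rs.
Proof.
move=> dn; pose F V := coincidence_poly d V 0 * coincidence_poly d V (2 - m%:R).
pose Z := \prod_(V : {set 'I_m} | V != set0) F V.
have Z0 : Z != 0.
  by apply/prodf_neq0 => V V0; rewrite mulf_neq0 // coincidence_poly_neq0.
have [rs Zrs] := closed_field_poly_normal Z.
exists rs => s t e e' y ys ee' es e's.
have [V V0 Vs] := branch_coincidence m2 ys ee' es e's.
have : root Z s.
  by rewrite /root horner_prod; apply/prodf_eq0; exists V.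
by rewrite Zrs rootZ ?lead_coef_eq0 // root_prod_XsubC.
Qed.

(** A repeated factor [A] of the cofactor [T] would give, for all but finitely many
    points [t] of a generic line [move0 d], a root [s] of [A]; then [T] at [s] is
    divisible by [('X - t) ^+ 2] as a polynomial along the line.  Two of its affine
    factors [L s e] vanish at [t], so [s] is one of the finitely many [rs]; but a
    parameter [t] outside the roots of [Big] satisfies [L s e != 0] for those. *)
Lemma tail_separable : separable_poly T.
Proof.
apply/contraT=> nsep.
have T0 : T != 0.
  have [d /tail0_neq0] := generic_nonempty (unbalanced_generic K m).
  by apply: contraNneq => ->; rewrite map_poly0 horner0.
have [c [A [B [c0 szA cT]]]] := nonseparable_square T0 nsep.
have [g g0 gP] : generic (fun d : 'I_m -> K =>
    ((forall i, d i != \sum_(j | j != i) d j) /\ no_signed_sum d) /\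
    (c.@[d] != 0 /\ (lead_coef A).@[d] != 0)).
  apply: generic_and; first exact/generic_and/no_signed_sum_generic/unbalanced_generic.
  apply: generic_and; first by exists c.
  by exists (lead_coef A); rewrite // lead_coef_eq0 -size_poly_gt0 ltnW.
have [d dg] := mpoly_nonroot g0.
have [[_ dn] _] := gP _ dg.
have [rs rsP] := coincidence_roots dn.
pose y s i := sqrtC (1 - d (lift ord0 i) * s).
have ys s i : y s i ^+ 2 = 1 - d (lift ord0 i) * s by rewrite sqrtCK.
pose L s (e : {ffun 'I_m' -> bool}) :=
  s *: 'X + ((2 - m%:R - signed_sum e (y s)) ^+ 2 - 1)%:P.
have szL s e : s != 0 -> size (L s e) = 2%N.
  move=> s0; rewrite /L size_polyDl size_scale ?size_polyX //.
  by rewrite ltnS size_polyC leq_b1.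
pose ell := restrict_line d.
pose Big := ell g * \prod_(s <- rs | s != 0) \prod_e L s e.
have d0 : move0 d (d ord0) = d.
  by apply: functional_extensionality_dep => i; rewrite /move0; case: eqP => // ->.
have Big0 : Big != 0.
  rewrite mulf_neq0 //.
    apply: contraNneq dg => ell0.
    by rewrite -d0 -restrict_lineE -/ell ell0 horner0.
  rewrite prodf_seq_neq0; apply/allP => s _; apply/implyP => s0.
  by apply/prodf_neq0 => e _; rewrite -size_poly_gt0 szL.
have [t] := poly_nonroot Big0; rewrite hornerM mulf_eq0 negb_or => /andP[].
rewrite restrict_lineE => /gP[[dt_ub _] [ct lt]].
set dt := move0 d t in dt_ub ct lt.
have /closed_rootP[s /eqP As] : size (map_poly (meval dt) A) != 1%N.
  by rewrite size_map_poly_id0 // gtn_eqF.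
have Ts : (map_poly (meval dt) T).[s] = 0.
  have := congr1 (fun f => (map_poly (meval dt) f).[s]) cT.
  rewrite map_polyZ rmorphM rmorphXn /= hornerZ hornerM horner_exp As expr0n mul0r.
  by move/eqP; rewrite mulf_eq0 (negbTE ct) /= => /eqP.
have s0 : s != 0 by apply: contra_eq_neq Ts => ->; apply: tail0_neq0.
rewrite horner_prod prodf_seq_neq0.
pose r := (map_poly ell T).[s%:P].
have rL : s ^+ m *: r = \prod_e L s e.
  apply: poly_eq_off0 => t' _; rewrite hornerZ map_restrict_lineE.
  rewrite -(elim_poly_move0 (ys s)) elim_poly_tail hornerM hornerXn //.
pose a := (map_poly ell A).[s%:P].
have dv_a : 'X - t%:P %| a.
  by rewrite dvdp_XsubCl /root map_restrict_lineE As.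
have dv_r : ('X - t%:P) ^+ 2 %| r.
  have : ('X - t%:P) ^+ 2 %| ell c * r.
    have -> : ell c * r = a ^+ 2 * (map_poly ell B).[s%:P].
      have := congr1 (fun f => (map_poly ell f).[s%:P]) cT.
      by rewrite map_polyZ rmorphM rmorphXn /= hornerZ hornerM horner_exp.
    by apply: dvdp_mulr; apply: dvdp_exp2r.
  rewrite Gauss_dvdpr // coprimep_expl // coprimep_sym coprimep_XsubC /root.
  by rewrite restrict_lineE.
have dv_L : ('X - t%:P) ^+ 2 %| \prod_e L s e by rewrite -rL dvdpZr ?expf_neq0.
have [e [e' [ee' es e's]]] := double_root_prod (szL s ^~ s0) dv_L.
have LE f : root (L s f) t -> s * t + ((2 - m%:R - signed_sum f (y s)) ^+ 2 - 1) = 0.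
  by rewrite /root /L hornerD hornerZ hornerX hornerC => /eqP.
have srs : s \in rs := rsP _ _ _ _ _ (ys s) ee' (LE _ es) (LE _ e's).
move/allP/(_ s srs); rewrite s0 /= horner_prod => /prodf_neq0/(_ e isT).
by move/negP.
Qed.

(** A Bezout relation between [T] and its derivative over the polynomial ring
    specializes wherever its constant does not vanish. *)
Lemma simple_elim_generic : generic (@simple_elim K m).
Proof.
have := tail_separable; rewrite separable_poly.unlock => /Bezout_coprimepP[[u v]] /=.
rewrite -size_poly_eq1 => /size_poly1P[c c0 uv].
exists c => // d dc s s0; set Td := map_poly (meval d) T.
have dE : elim_poly d = 'X^m * Td := elim_poly_tail d.
rewrite /root dE hornerM hornerXn mulf_eq0 expf_eq0 (negbTE s0) /= => /eqP Ts.
rewrite derivM hornerD !hornerM Ts mulr0 add0r hornerXn.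
apply: contraNneq dc => T's.
have := congr1 (fun f => (map_poly (meval d) f).[s]) uv.
rewrite rmorphD !rmorphM /= -deriv_map map_polyC hornerC hornerD !hornerM -/Td Ts => <-.
have -> : Td^`().[s] = 0.
  by move/eqP: T's; rewrite mulf_eq0 expf_eq0 (negbTE s0) => /eqP.
by rewrite !mulr0 addr0.
Qed.

End SeparabilityTheorem.

(** * Counting the weights on a complete graph with given degrees *)

(** The equations of the beta model on the complete graph with vertices ['I_m]. *)
Definition complete_sol (K : fieldType) m (d : 'I_m -> K) (M : 'M[K]_m) : Prop :=
  [/\ forall a b, M a b = M b a, forall a, M a a = 0,
      forall a b c e, uniq [:: a; b; c; e] -> M a b * M c e = M a c * M b e
    & forall a, \sum_b M a b = d a].

Lemma fresh_ord m (s : seq 'I_m) : (size s < m)%N -> exists c, c \notin s.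
Proof.
move=> sm; apply/existsP/contraT; rewrite negb_exists => /forallP s_all.
move: sm; rewrite ltnNge -{1}(card_ord m) cardE uniq_leq_size ?enum_uniq // => c _.
by have := s_all c; rewrite negbK.
Qed.

Section CompleteCount.
Variables (K : numClosedFieldType) (m : nat).
Hypothesis m3 : (3 < m)%N.
Variable d : 'I_m -> K.
Hypotheses (d_neq0 : forall i, d i != 0)
  (d_unbalanced : forall i, d i != \sum_(j | j != i) d j)
  (d_signed : no_signed_sum d)
  (d_branch : forall i, (elim_poly d).[(d i)^-1] != 0)
  (d_simple : simple_elim d).

Let m0 : (0 < m)%N. Proof. exact: leq_trans m3. Qed.

Lemma elim_poly_roots : exists rs : seq K,
  [/\ uniq rs, size rs = (2 ^ m.-1 - m)%N &
      forall s, (s \in rs) = (s != 0) && root (elim_poly d) s].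
Proof.
have [h dh /(_ d_unbalanced) h0] := elim_poly_order d.
have sz : size (elim_poly d) = (2 ^ m.-1).+1.
  have [le lc] := line_norm_top (fun=> 1) d (2 - m%:R) m0.
  apply/eqP; rewrite eqn_leq le ltnNge; apply/negP => /(nth_default 0).
  rewrite lc => /eqP; apply/negP.
  have := d_signed (U := setT); rewrite -card_gt0 cardsT card_ord => /(_ m0).
  congr (_.[_] != 0); congr sign_norm.
  by apply: functional_extensionality_dep => i; rewrite inE.
have hN0 : h != 0 by apply: contraNneq h0 => ->; rewrite horner0.
have szh : size h = (2 ^ m.-1 - m).+1.
  move: sz; rewrite dh size_monicM ?monicXn // size_polyXn addSn /=.
  move=> szm; rewrite -[size h](addKn m) szm subSn // -ltnS -szm -addn1 leq_add2l.
  by rewrite size_poly_gt0.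
have [rs hrs] := closed_field_poly_normal h.
have rsE s : (s \in rs) = (s != 0) && root (elim_poly d) s.
  have -> : (s \in rs) = root h s.
    by rewrite hrs rootZ ?lead_coef_eq0 // root_prod_XsubC.
  have [->|s0] := eqVneq s 0; first by apply/negbTE; rewrite /root.
  by rewrite dh rootM /root hornerXn expf_eq0 (negbTE s0) andbF.
exists rs; split=> //; last first.
  have := szh; rewrite hrs size_scale ?lead_coef_eq0 // size_prod_XsubC.
  by case.
rewrite -separable_prod_XsubC.
have -> : separable_poly (\prod_(z <- rs) ('X - z%:P)) = separable_poly h.
  by rewrite [in RHS]hrs; apply: eqp_separable; rewrite eqp_sym eqp_scale ?lead_coef_eq0.
rewrite separable_poly.unlock; apply/Pdiv.ClosedField.coprimepP => s hs.
have s0 : s != 0 by apply: contraNneq h0 => s0; rewrite s0 in hs.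
have := d_simple s0; rewrite dh rootM hs orbT => /(_ isT).
apply: contraNneq; rewrite derivM /root hornerD !hornerM => ->.
by rewrite (eqP hs) !mulr0 addr0.
Qed.

(** Two choices at the same [s] would make [s] a double root. *)
Lemma branch_unique s (y z : 'I_m -> K) : s != 0 ->
  (forall i, y i ^+ 2 = 1 - d i * s) -> (forall i, z i ^+ 2 = 1 - d i * s) ->
  \sum_i y i = 2 - m%:R -> \sum_i z i = 2 - m%:R -> y =1 z.
Proof.
move=> s0 ys zs yk zk i; apply/eqP/contraT => yz.
have rs : root (elim_poly d) s by apply/eqP/(line_norm0 ys).
have y0 j : y j != 0.
  apply: contraNneq (d_branch j) => yj; have := ys j; rewrite yj expr0n => /esym/eqP.
  rewrite subr_eq0 => /eqP dj; rewrite (_ : (d j)^-1 = s) //.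
  by rewrite -[RHS](mulKf (d_neq0 j)) -dj mulr1.
have := d_simple s0 rs.
by rewrite (elim_poly_double_root ys zs y0 yk zk) //; exists i.
Qed.

Definition branch_mx (s : K) (y : 'I_m -> K) : 'M[K]_m :=
  \matrix_(a, b) (if a == b then 0 else (1 + y a) * (1 + y b) / s).

Lemma branch_mx_sol s y : s != 0 -> (forall i, y i ^+ 2 = 1 - d i * s) ->
  \sum_i y i = 2 - m%:R -> complete_sol d (branch_mx s y).
Proof.
move=> s0 ys yk; split=> [a b|a|a b c e|a].
- by rewrite !mxE eq_sym [(1 + y a) * _]mulrC.
- by rewrite mxE eqxx.
- rewrite /= !inE !negb_or -!andbA => /and5P[ab ac ae bc /and3P[be ce _]].
  by rewrite !mxE (negbTE ab) (negbTE ac) (negbTE be) (negbTE ce); ring.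
rewrite (bigD1 a) //= mxE eqxx add0r.
have -> : \sum_(i | i != a) branch_mx s y a i =
    (1 + y a) / s * \sum_(i | i != a) (1 + y i).
  rewrite mulr_sumr; apply: eq_bigr => i ia.
  by rewrite mxE eq_sym (negbTE ia) mulrAC.
have : \sum_i (1 + y i) = 2 by rewrite big_split /= yk sumr_const card_ord addrC subrK.
rewrite (bigD1 a) //= => /(canRL (addKr _)) ->.
have -> : (1 + y a) / s * (- (1 + y a) + 2) = (1 - y a ^+ 2) / s by ring.
by rewrite ys; field.
Qed.

Lemma branch_mx_inj s s' y y' : s != 0 -> s' != 0 ->
  (forall i, y i ^+ 2 = 1 - d i * s) -> (forall i, y' i ^+ 2 = 1 - d i * s') ->
  \sum_i y i = 2 - m%:R -> \sum_i y' i = 2 - m%:R ->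
  branch_mx s y = branch_mx s' y' -> s = s'.
Proof.
move=> s0 s'0 ys ys' yk yk' /matrixP E.
have nz t (z : 'I_m -> K) i : (forall i, z i ^+ 2 = 1 - d i * t) -> t != 0 ->
    1 + z i != 0.
  move=> zt t0; apply/negP => /eqP z1; have : (1 + z i) * (1 - z i) = d i * t.
    by transitivity (1 - z i ^+ 2); [|rewrite zt]; ring.
  by rewrite z1 mul0r => /esym/eqP; rewrite mulf_eq0 (negbTE (d_neq0 i)) (negbTE t0).
have sum2 (z : 'I_m -> K) : \sum_i z i = 2 - m%:R -> \sum_i (1 + z i) = 2.
  by move=> zk; rewrite big_split /= zk sumr_const card_ord addrC subrK.
have Eab a b : a != b -> (1 + y a) * (1 + y b) / s = (1 + y' a) * (1 + y' b) / s'.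
  by move=> ab; have := E a b; rewrite !mxE (negbTE ab).
(* The two vectors 1 + y and 1 + y' are proportional, hence equal. *)
have cross a b : (1 + y a) * (1 + y' b) = (1 + y b) * (1 + y' a).
  have [->//|ab] := eqVneq a b.
  have [c] := @fresh_ord m [:: a; b] (ltnW m3).
  rewrite !inE negb_or ![c == _]eq_sym => /andP[ac bc].
  have yc := nz s y c ys s0; have yc' := nz s' y' c ys' s'0.
  have nzf : (1 + y c) / s * ((1 + y' c) / s') != 0.
    by rewrite !mulf_neq0 ?invr_eq0.
  apply: (mulIf nzf).
  have -> : (1 + y a) * (1 + y' b) * ((1 + y c) / s * ((1 + y' c) / s')) =
            ((1 + y a) * (1 + y c) / s) * ((1 + y' b) * (1 + y' c) / s') by ring.
  by rewrite (Eab _ _ ac) -(Eab _ _ bc); ring.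
have yy' a : 1 + y a = 1 + y' a.
  have two0 : (2 : K) != 0 by rewrite pnatr_eq0.
  apply: (mulIf two0); rewrite -{1}(sum2 _ yk') -(sum2 _ yk) !mulr_sumr.
  by apply: eq_bigr => b _; rewrite cross mulrC.
pose a := Ordinal m0; have [b] := @fresh_ord m [:: a] (ltnW (ltnW m3)).
rewrite inE eq_sym => ab; have := Eab a b ab.
rewrite -!yy' => /(mulfI _)/invr_inj -> //.
by apply/mulf_neq0; apply: nz s0.
Qed.

(** If [M a b = 0], then [a] and [b] have a single common neighbour [c], for
    disjoint edges [a - x] and [b - z] would force [M a b != 0].  Every other edge
    must meet the edge [a - c] for the same reason, so the support is a star with
    centre [c], which an unbalanced [d] does not allow. *)
Lemma complete_sol_neq0 M : complete_sol d M -> forall a b, a != b -> M a b != 0.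
Proof.
case=> Msym Mdiag M4 Mdeg a b ab; apply/negP => /eqP Mab.
have neq x z : M x z != 0 -> x != z.
  by apply: contraNneq => ->; rewrite Mdiag.
have nbr x : exists z, M x z != 0.
  apply/existsP; apply: contraNT (d_neq0 x); rewrite negb_exists => /forallP Mx0.
  by rewrite -Mdeg big1 // => z _; have := Mx0 z; rewrite negbK => /eqP.
have common c e : M a c != 0 -> M b e != 0 -> c = e.
  move=> Mac Mbe; apply/eqP/contraT => ce.
  have cb : c != b by apply: contraNneq Mac => ->; rewrite Mab.
  have ea : e != a by apply: contraNneq Mbe => ->; rewrite Msym Mab.
  have := M4 a c b e; rewrite Mab mul0r /= !inE !negb_or (neq _ _ Mac) ab (neq _ _ Mbe).
  rewrite (eq_sym a e) ea cb ce => /(_ isT)/eqP.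
  by rewrite mulf_eq0 (negbTE Mac) (negbTE Mbe).
have [c Mac] := nbr a; have [e Mbe] := nbr b.
have ec : e = c by rewrite (common c e).
rewrite {e}ec in Mbe.
have only_c f g : f != c -> M f g != 0 -> g = c.
  move=> fc Mfg; apply/eqP/contraT => gc.
  have fa : f != a by apply: contraNneq gc => fa; apply/eqP/common; rewrite -?fa.
  have fb : f != b.
    by apply: contraNneq gc => fb; rewrite eq_sym; apply/eqP/common; rewrite -?fb.
  have Maf : M a f = 0.
    by apply/eqP; apply: contraNT fc => Maf; apply/eqP/common.
  have ga : g != a by apply: contraNneq Mfg => ->; rewrite Msym Maf.
  have := M4 f g a c; rewrite (Msym f a) Maf mul0r /= !inE !negb_or (neq _ _ Mfg) fa fc.
  rewrite ga gc (neq _ _ Mac) => /(_ isT)/eqP.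
  by rewrite mulf_eq0 (negbTE Mfg) (negbTE Mac).
case/eqP: (d_unbalanced c); rewrite -Mdeg (bigD1 c) //= Mdiag add0r.
apply: eq_bigr => f fc; rewrite -Mdeg (bigD1 c) //= big1 ?addr0 // => g gc.
by apply/eqP; apply: contraNT gc => /(only_c f g fc) ->.
Qed.

(** Fix a vertex [o].  The quantity [M o a * M o b / M a b] does not depend on the
    pair [a, b] of other vertices; with its value [rho] as the weight of [o] and
    [M o a] as the weight of [a] the matrix factors. *)
Lemma complete_sol_rank1 M : complete_sol d M ->
  exists (z : 'I_m -> K) rho, [/\ rho != 0, forall a, z a != 0 &
    forall a b, a != b -> M a b = z a * z b / rho].
Proof.
move=> Msol; have MN0 := complete_sol_neq0 Msol; case: Msol => Msym _ M4 _.
pose o := Ordinal m0.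
have [b0] := @fresh_ord m [:: o] (ltnW (ltnW m3)).
have [c0] := @fresh_ord m [:: o; b0] (ltnW m3).
rewrite !inE negb_or ![_ == o]eq_sym (eq_sym c0) => /andP[oc0 bc0] ob0.
pose r a b := M o a * M o b / M a b.
have r_sym a b : r a b = r b a by rewrite /r (Msym b a) [M o b * _]mulrC.
have rE a b c : o != a -> o != b -> o != c -> a != b -> a != c -> r a b = r a c.
  move=> oa ob oc ab ac; have [->//|bc] := eqVneq b c.
  rewrite /r; apply: (mulIf (mulf_neq0 (MN0 _ _ ab) (MN0 _ _ ac))).
  have E : M o b * M a c = M o c * M a b.
    rewrite (M4 o b a c) ?(M4 o c a b) 1?(Msym b c) //= !inE !negb_or.
      by rewrite oc oa ob (eq_sym c a) ac (eq_sym c b) bc ab.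
    by rewrite ob oa oc (eq_sym b a) ab bc ac.
  transitivity (M o a * (M o b * M a c)); first by field; rewrite MN0.
  by rewrite E; field; rewrite MN0.
have r_const a b : o != a -> o != b -> a != b -> r a b = r b0 c0.
  move=> oa ob ab; have [a_b0|ab0] := eqVneq a b0; first by subst a; apply: rE.
  by rewrite (rE a b b0) // r_sym; apply: rE => //; rewrite eq_sym.
pose rho := r b0 c0.
have rho0 : rho != 0 by rewrite !mulf_neq0 ?invr_eq0 ?MN0.
exists (fun a => if a == o then rho else M o a), rho; split=> // [a|a b ab].
  by have [//|ao] := eqVneq a o; rewrite MN0 // eq_sym.
have [a_o|ao] := eqVneq a o; have [b_o|bo] := eqVneq b o.
- by rewrite a_o b_o eqxx in ab.
- by rewrite a_o mulrAC divff ?mul1r.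
- by rewrite b_o mulfK // Msym.
rewrite -[rho](r_const a b) // 1?eq_sym // /r; field.
by rewrite !MN0 // eq_sym.
Qed.

(** With [sig] the sum of the weights [z], the normalization [1 + y = 2 z / sig]
    is the one for which the degree equations read [y a ^+ 2 = 1 - d a * s].  If
    [sig] were 0, the [z a / sqrtC rho] would be square roots of the [- d a]
    with sum 0. *)
Lemma complete_sol_branch M : complete_sol d M -> exists s y,
  [/\ s != 0, forall i, y i ^+ 2 = 1 - d i * s, \sum_i y i = 2 - m%:R &
      M = branch_mx s y].
Proof.
move=> Msol; have [z [rho [rho0 z0 Mz]]] := complete_sol_rank1 Msol.
case: (Msol) => _ Mdiag _ Mdeg; pose sig := \sum_i z i.
have dz a : z a * (sig - z a) = d a * rho.
  rewrite -Mdeg (bigD1 a) //= Mdiag add0r /sig [in LHS](bigD1 a) //= [z a + _]addrC addrK.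
  rewrite mulr_suml mulr_sumr; apply: eq_bigr => b ba.
  by rewrite Mz 1?eq_sym // divfK.
have sig0 : sig != 0.
  apply: contraTneq (d_signed (U := setT) _) => [sig0|]; last first.
    by rewrite -card_gt0 cardsT card_ord.
  pose r := sqrtC rho; have r2 : r ^+ 2 = rho by rewrite sqrtCK.
  have r0 : r != 0 by rewrite -sqrf_eq0 r2.
  rewrite negbK (@sign_normE _ _ _ (fun i => z i / r)) => [|i]; last first.
    rewrite inE exprMn exprVn r2; apply: (mulIf rho0); rewrite divfK // mulNr -dz sig0.
    by ring.
  apply/prodf_eq0; exists [ffun=> false] => //; rewrite sub0r oppr_eq0 /signed_sum.
  rewrite (eq_bigr (fun i => z i / r)) => [|i _]; last by rewrite ffunE mul1r.
  by rewrite -mulr_suml -/sig sig0 mul0r.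
exists (4 * rho / sig ^+ 2), (fun i => 2 * z i / sig - 1); split.
- by rewrite !mulf_neq0 ?invr_eq0 ?expf_neq0 ?pnatr_eq0.
- move=> i; have -> : d i = z i * (sig - z i) / rho by rewrite dz mulfK.
  by field; rewrite sig0.
- rewrite sumrB -mulr_suml -mulr_sumr -/sig mulfK // sumr_const card_ord //.
- apply/matrixP => a b; rewrite mxE; have [->|ab] := eqVneq; first by rewrite Mdiag.
  by rewrite Mz //; field; rewrite rho0 sig0.
Qed.

Theorem complete_count :
  exists2 f : 'I_(2 ^ m.-1 - m) -> 'M[K]_m, injective f &
    forall M, complete_sol d M <-> exists i, f i = M.
Proof.
have [rs [rs_uniq <- rsE]] := elim_poly_roots.
have rs0 (i : 'I_(size rs)) : rs`_i != 0 /\ root (elim_poly d) rs`_i.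
  by apply/andP; rewrite -rsE mem_nth.
have /fin_all_exists2[y ys yk] (i : 'I_(size rs)) :
    exists2 y : 'I_m -> K, forall j, y j ^+ 2 = 1 - d j * rs`_i & \sum_j y j = 2 - m%:R.
  by apply: line_norm_root; apply/eqP/(rs0 i).2.
exists (fun i : 'I_(size rs) => branch_mx rs`_i (y i)) => [i j E|M].
  apply/val_inj/eqP; rewrite -(nth_uniq 0 (ltn_ord i) (ltn_ord j) rs_uniq).
  apply/eqP; apply: branch_mx_inj (ys i) (ys j) (yk i) (yk j) E.
    by case: (rs0 i).
  by case: (rs0 j).
split=> [/complete_sol_branch[s [z [s0 zs zk ->]]]|[i <-]]; last first.
  by apply: branch_mx_sol => //; case: (rs0 i).
have srs : s \in rs by rewrite rsE s0; apply/eqP/(line_norm0 zs).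
have si : (index s rs < size rs)%N by rewrite index_mem.
exists (Ordinal si); have := ys (Ordinal si); rewrite /= nth_index // => ysi.
congr branch_mx; apply: functional_extensionality_dep.
exact: branch_unique s0 ysi zs (yk _) zk.
Qed.
End CompleteCount.

(** * Weights on vertex pairs and the rows of the design matrix *)

Section WeightSums.
Variables (R : nzRingType) (k : nat) (n : 'I_k -> nat).
Implicit Type c : vertex n -> vertex n -> R.

Lemma sum_vertex (F : vertex n -> R) (P : pred 'I_k) :
  \sum_(x | P (tag x)) F x = \sum_(i | P i) \sum_(t : 'I_(n i)) F (vtx t).
Proof.
rewrite (sig_big_dep _ (fun i t => true) (fun i t => F (vtx t))) /=.
by apply: eq_big => [x|[i t] _ //]; rewrite andbT.
Qed.

Definition block_sum c (i j : 'I_k) : R :=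
  \sum_(t : 'I_(n i)) \sum_(w : 'I_(n j)) c (vtx t) (vtx w).

(** The weight between [t] and the vertex to which the outside of its block is
    collapsed. *)
Definition outside c (i : 'I_k) (t : 'I_(n i)) : R :=
  \sum_(j | j != i) \sum_(w : 'I_(n j)) c (vtx t) (vtx w).

(** Index [ord0] stands for the collapsed outside of block [i]. *)
Definition collapsed_degree c (i : 'I_k) (a : 'I_(n i).+1) : R :=
  if unlift ord0 a is Some t then \sum_y c (vtx t) y
  else \sum_(j | j != i) block_sum c i j.

Definition collapse c (i : 'I_k) : 'M[R]_((n i).+1) :=
  \matrix_(a, b) match unlift ord0 a, unlift ord0 b with
                 | Some t, Some w => c (vtx t) (vtx w)
                 | Some t, None | None, Some t => outside c t
                 | None, None => 0
                 end.

Lemma degree_split c i (t : 'I_(n i)) :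
  \sum_y c (vtx t) y = outside c t + \sum_(u : 'I_(n i)) c (vtx t) (vtx u).
Proof.
rewrite (sum_vertex _ xpredT) (bigD1 i) //= addrC; congr (_ + _).
Qed.

Lemma sum_outside c i :
  \sum_(t : 'I_(n i)) outside c t = \sum_(j | j != i) block_sum c i j.
Proof. by rewrite exchange_big. Qed.

End WeightSums.

Section Coordinates.
Variables (K : numFieldType) (k : nat) (n : 'I_k -> nat).
Local Notation vertex := (vertex n).
Local Notation edge := (edge n).
Local Notation point := 'cV[K]_#|edge|.
Implicit Types (p u : point) (x y : vertex) (e : edge).

Lemma coordE p x y :
  coord p x y = \sum_e ([set x; y] == val e)%:R * p (enum_rank e) ord0.
Proof.
rewrite /coord; case: insubP => [e _ ve|nE].
  rewrite (bigD1 e) //= -ve eqxx mul1r big1 ?addr0 // => e' e'e.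
  by rewrite (inj_eq val_inj) eq_sym (negbTE e'e) mul0r.
rewrite big1 // => e _; case: eqP => [xye|_]; rewrite ?mul0r //.
by case/negP: nE; rewrite xye (valP e).
Qed.

Lemma coordC p x y : coord p x y = coord p y x.
Proof. by rewrite !coordE setUC. Qed.

Lemma coordxx p x : coord p x x = 0.
Proof. by rewrite /coord insubF // setUid cards1. Qed.

Lemma coordB p u x y : coord (p - u) x y = coord p x y - coord u x y.
Proof.
by rewrite !coordE -sumrB; apply: eq_bigr => e _; rewrite !mxE mulrBr.
Qed.

Lemma edgeP e : exists x y, x != y /\ val e = [set x; y].
Proof. by have /cards2P[x [y [xy eE]]] := valP e; exists x, y. Qed.

Lemma sum_endpoints e a b (F : vertex -> vertex -> K) :
  a != b -> val e = [set a; b] ->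
  \sum_x \sum_y ([set x; y] == val e)%:R * F x y = F a b + F b a.
Proof.
move=> ab ->; rewrite pair_bigA /= (bigD1 (a, b)) //= eqxx mul1r.
rewrite (bigD1 (b, a)) /= ?xpair_eqE ?(eq_sym b) ?(negbTE ab) //.
rewrite [[set b; a]]setUC eqxx mul1r big1 ?addr0 // => -[x y] /= /andP[xyab xyba].
case: eqP => [xyE|_]; rewrite ?mul0r //.
have /set2P xE : x \in [set a; b] by rewrite -xyE set21.
have /set2P yE : y \in [set a; b] by rewrite -xyE set22.
case: xE yE xyE xyab xyba => -> [] -> xyE; rewrite ?eqxx //.
  by move: (set22 a b) ab; rewrite -xyE => /set2P[]->; rewrite eqxx.
by move: (set21 a b) ab; rewrite -xyE => /set2P[]->; rewrite eqxx.
Qed.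

(** Turns sums over edges into sums over ordered pairs; each edge is counted
    twice, and the diagonal contributes 0. *)
Lemma sum_coord p (F : vertex -> vertex -> K) (h : edge -> K) :
  (forall e x y, x != y -> val e = [set x; y] -> F x y = h e) ->
  \sum_x \sum_y F x y * coord p x y = (\sum_e h e * p (enum_rank e) ord0) *+ 2.
Proof.
move=> Fh; transitivity (\sum_e \sum_x \sum_y ([set x; y] == val e)%:R *
                           (F x y * p (enum_rank e) ord0)).
  rewrite [RHS]exchange_big /=; apply: eq_bigr => x _.
  rewrite [RHS]exchange_big /=; apply: eq_bigr => y _.
  by rewrite coordE mulr_sumr; apply: eq_bigr => e _; rewrite mulrCA.
rewrite -sumrMnl; apply: eq_bigr => e _.
have [a [b [ab eE]]] := edgeP e; rewrite (sum_endpoints _ ab eE).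
rewrite (Fh e a b) // (Fh e b a) ?mulr2n //; first by rewrite eq_sym.
by rewrite setUC.
Qed.

Lemma coord_inj p u : (forall x y, coord p x y = coord u x y) -> p = u.
Proof.
move=> pu; apply/matrixP => r c; rewrite ord1 -[r]enum_valK.
have [a [b [ab eE]]] := edgeP (enum_val r).
have coordp (v : point) : coord v a b = v (enum_rank (enum_val r)) ord0.
  rewrite coordE (bigD1 (enum_val r)) //= eE eqxx mul1r big1 ?addr0 // => e er.
  by rewrite -eE (inj_eq val_inj) eq_sym (negbTE er) mul0r.
by rewrite -!coordp.
Qed.

(** Points can be prescribed by their coordinates.  Summing [G] over both
    orderings of an edge avoids choosing one. *)
Lemma coord_exists (G : vertex -> vertex -> K) :
  (forall x y, G x y = G y x) -> (forall x, G x x = 0) ->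
  exists p, forall x y, coord p x y = G x y.
Proof.
move=> Gsym Gdiag.
exists (\col_r ((\sum_x \sum_y ([set x; y] == val (enum_val r))%:R * G x y) / 2)).
move=> x y; have [->|xy] := eqVneq x y; first by rewrite coordxx Gdiag.
have cxy : #|[set x; y]| == 2%N by rewrite cards2 xy.
pose e0 : edge := exist (fun e : {set vertex} => #|e| == 2%N) _ cxy.
rewrite coordE (bigD1 e0) //= eqxx mul1r mxE enum_rankK.
rewrite (@sum_endpoints e0 _ _ _ xy) // (Gsym y) -mulr2n -(mulr_natr (G x y)).
rewrite mulfK ?pnatr_eq0 //.
rewrite big1 ?addr0 // => e; rewrite -(inj_eq val_inj) eq_sym => /negbTE-> /=.
by rewrite mul0r.
Qed.

Lemma block_sumC p i j : block_sum (coord p) i j = block_sum (coord p) j i.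
Proof.
rewrite /block_sum exchange_big; apply: eq_bigr => w _; apply: eq_bigr => t _.
exact: coordC.
Qed.

Lemma design_mxE p (r : parameter n) :
  (design_mx K n *m p) (enum_rank r) ord0 =
  \sum_e (design_entry r e)%:R * p (enum_rank e) ord0.
Proof.
rewrite mxE (reindex enum_rank) /=; last exact/onW_bij/enum_rank_bij.
by apply: eq_bigr => e _; rewrite mxE !enum_rankK.
Qed.

Lemma design_vertex p x :
  (design_mx K n *m p) (enum_rank (inl x : parameter n)) ord0 = \sum_y coord p x y.
Proof.
have two0 : (2 : K) != 0 by rewrite pnatr_eq0.
apply: (mulIf two0); rewrite !mulr_natr design_mxE /=.
rewrite -(@sum_coord p (fun a b => (a == x)%:R + (b == x)%:R)) => [|e a b ab ->]; last first.
  rewrite !inE ![x == _]eq_sym -natrD; case: eqVneq => // ax.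
  by rewrite -ax eq_sym (negbTE ab).
transitivity (\sum_y coord p x y + \sum_y coord p y x).
  under eq_bigr do rewrite (eq_bigr _ (fun _ _ => mulrDl _ _ _)) big_split /=.
  rewrite big_split /=; congr (_ + _).
    rewrite (bigD1 x) //= [X in _ + X]big1 ?addr0 => [|a /negbTE ax]; last first.
      by rewrite big1 // => b _; rewrite ax mul0r.
    by apply: eq_bigr => b _; rewrite eqxx mul1r.
  apply: eq_bigr => a _; rewrite (bigD1 x) //= eqxx mul1r big1 ?addr0 // => b /negbTE->.
  by rewrite mul0r.
by rewrite mulr2n; congr (_ + _); apply: eq_bigr => y _; rewrite coordC.
Qed.

Lemma design_block p (b : block_pair k) :
  (design_mx K n *m p) (enum_rank (inr b : parameter n)) ord0 *+ 2 =
  \sum_i \sum_j (val b == [set i; j])%:R * block_sum (coord p) i j.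
Proof.
rewrite design_mxE /=.
rewrite -(@sum_coord p (fun x y => (val b == [set tag x; tag y])%:R)) => [|e x y _ ->]; last first.
  by rewrite imsetU !imset_set1.
rewrite (sum_vertex _ xpredT) /=; apply: eq_bigr => i _.
rewrite exchange_big /= (sum_vertex _ xpredT) /=; apply: eq_bigr => j _.
rewrite /block_sum exchange_big /= mulr_sumr; apply: eq_bigr => w _.
by rewrite mulr_sumr.
Qed.

(** The rows of the design matrix are the vertex degrees and the block sums; the
    sums within a block are counted twice in [block_sum]. *)
Lemma design_mx_eq0 p : design_mx K n *m p = 0 <->
  (forall x, \sum_y coord p x y = 0) /\ (forall i j, block_sum (coord p) i j = 0).
Proof.
split=> [Ap0|[deg0 S0]]; last first.
  apply/matrixP => r c; rewrite ord1 -[r]enum_valK [RHS]mxE.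
  case: (enum_val r) => [x|b]; first by rewrite design_vertex deg0.
  have /eqP : (design_mx K n *m p) (enum_rank (inr b : parameter n)) ord0 *+ 2 = 0.
    rewrite design_block big1 // => i _.
    by rewrite big1 // => j _; rewrite S0 mulr0.
  by rewrite mulrn_eq0 => /eqP.
split=> [x|i j]; first by rewrite -design_vertex Ap0 mxE.
have bij : (0 < #|[set i; j]| <= 2)%N by rewrite cards2; case: (i != j).
have in_pair a b : [set i; j] = [set a; b] -> (a \in [set i; j]) && (b \in [set i; j]).
  by move=> ->; rewrite set21 set22.
have := design_block p (exist (fun b : {set 'I_k} => (0 < #|b| <= 2)%N) _ bij).
rewrite Ap0 mxE mul0rn pair_bigA /= => /esym.
rewrite (bigD1 (i, j)) //= eqxx mul1r; have [ij|ij] := eqVneq i j.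
  rewrite big1 ?addr0 // => -[a b] /= ab; case: eqP => [/in_pair|]; rewrite ?mul0r //.
  by rewrite -ij !inE !orbb => /andP[/eqP aE /eqP bE]; rewrite aE bE -ij eqxx in ab.
rewrite (bigD1 (j, i)) /= ?xpair_eqE ?(eq_sym j) ?(negbTE ij) //.
rewrite [[set j; i]]setUC eqxx mul1r -block_sumC big1 ?addr0 => [/eqP|[a b] /= /andP[ab ba]].
  by rewrite -mulr2n mulrn_eq0 => /eqP.
case: eqP => [ijab|_]; rewrite ?mul0r //=.
have /andP[/set2P aE /set2P bE] := in_pair _ _ ijab.
have : (i == a) || (i == b) by have := set21 i j; rewrite ijab !inE.
have : (j == a) || (j == b) by have := set22 i j; rewrite ijab !inE.
move: ab ba; rewrite !xpair_eqE; case: aE bE => -> [] ->; rewrite ?eqxx ?orbb //=.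
  by rewrite (eq_sym j) (negbTE ij).
by rewrite (negbTE ij).
Qed.

End Coordinates.

(** * Decoupling of the blocks *)

Section Decoupling.
Variables (K : numFieldType) (k : nat) (n : 'I_k -> nat).
Local Notation vertex := (vertex n).
Local Notation point := 'cV[K]_#|edge n|.
Implicit Types (p u : point) (x y : vertex).

Local Notation total u i := (\sum_(j | j != i) block_sum (coord u) i j).

Definition toric p :=
  [/\ within_block_eqs p, three_one_eqs p, two_two_eqs p & two_one_one_eqs p].

Lemma likelihood_eqsE u p : likelihood_eqs u p <->
  [/\ forall x, \sum_y coord p x y = \sum_y coord u x y,
      forall i j, block_sum (coord p) i j = block_sum (coord u) i j & toric p].
Proof.
have degB x : \sum_y coord (p - u) x y = \sum_y coord p x y - \sum_y coord u x y.
  by rewrite -sumrB; apply: eq_bigr => y _; rewrite coordB.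
have sumB i j : block_sum (coord (p - u)) i j =
    block_sum (coord p) i j - block_sum (coord u) i j.
  rewrite /block_sum -sumrB; apply: eq_bigr => t _.
  by rewrite -sumrB; apply: eq_bigr => w _; rewrite coordB.
rewrite /likelihood_eqs design_mx_eq0; split=> [[[deg0 sum0] tor]|[deg sum tor]].
  split=> // [x|i j]; apply/eqP; rewrite -subr_eq0.
    by rewrite -degB deg0.
  by rewrite -sumB sum0.
by split=> //; split=> [x|i j]; rewrite ?degB ?sumB ?deg ?sum subrr.
Qed.

Section Toric.
Variable p : point.
Hypothesis p_toric : toric p.
Local Notation g := (coord p).

(** The 2-2 and 2-1-1 equations together: the rows of block [i] in the columns outside
    of [i] are proportional. *)
Lemma toric_minor i (t t' : 'I_(n i)) j (v : 'I_(n j)) l (w : 'I_(n l)) :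
  j != i -> l != i ->
  g (vtx t) (vtx v) * g (vtx t') (vtx w) = g (vtx t) (vtx w) * g (vtx t') (vtx v).
Proof.
case: p_toric => _ _ tor22 tor211 ji li.
have [<-|tt'] := eqVneq t t'; first by rewrite mulrC.
have [jl|jl] := eqVneq j l; last first.
  apply/eqP; rewrite -subr_eq0; apply/eqP/tor211 => //=.
  by rewrite !inE negb_or ![i == _]eq_sym ji li jl.
move: w li; rewrite -jl => w _; have [->//|vw] := eqVneq v w.
by apply/eqP; rewrite -subr_eq0; apply/eqP/tor22; rewrite // eq_sym.
Qed.

(** The 3-1 equation summed over all vertices outside of the block is the
    four-point equation with the collapsed vertex. *)
Lemma toric_outside i (t u v : 'I_(n i)) : uniq [:: t; u; v] ->
  outside g t * g (vtx u) (vtx v) = g (vtx t) (vtx u) * outside g v.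
Proof.
case: p_toric => _ tor31 _ _ tuv; rewrite mulr_suml mulr_sumr.
apply: eq_bigr => j ji; rewrite mulr_suml mulr_sumr; apply: eq_bigr => w _.
by apply/eqP; rewrite -subr_eq0; apply/eqP/tor31; rewrite // eq_sym.
Qed.

(** The proportionality of the rows of block [i], and then of the rows of block
    [j], summed over all their columns. *)
Lemma toric_cross i j (t : 'I_(n i)) (w : 'I_(n j)) : i != j ->
  g (vtx t) (vtx w) * (total p i * total p j) =
  block_sum g i j * outside g t * outside g w.
Proof.
move=> ij; pose col i0 y : K := \sum_(t' : 'I_(n i0)) g (vtx t') y.
have colE i0 j0 (t0 : 'I_(n i0)) (w0 : 'I_(n j0)) : j0 != i0 ->
    g (vtx t0) (vtx w0) * total p i0 = outside g t0 * col i0 (vtx w0).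
  move=> ji; rewrite -sum_outside mulr_sumr [RHS]mulr_sumr; apply: eq_bigr => t' _.
  rewrite mulr_sumr mulr_suml; apply: eq_bigr => l li.
  by rewrite mulr_sumr mulr_suml; apply: eq_bigr => w' _; apply: toric_minor.
rewrite mulrA colE 1?eq_sym //.
rewrite -[LHS]mulrA.
have -> : col i (vtx w) * total p j = outside g w * block_sum g i j.
  rewrite mulr_suml mulr_sumr; apply: eq_bigr => t' _.
  rewrite coordC colE //; congr (_ * _); apply: eq_bigr => w' _; exact: coordC.
by ring.
Qed.

Lemma toric_collapse i : complete_sol (collapsed_degree g (i := i)) (collapse g i).
Proof.
have [tor4 _ _ _] := p_toric.
have gC x y : g x y = g y x := coordC p x y.
have within (t u v w : 'I_(n i)) : uniq [:: t; u; v; w] ->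
    g (vtx t) (vtx u) * g (vtx v) (vtx w) = g (vtx t) (vtx v) * g (vtx u) (vtx w).
  by move=> tuvw; apply/eqP; rewrite -subr_eq0; apply/eqP/(tor4 i).
have out3 (t u v : 'I_(n i)) : t != u -> t != v -> u != v ->
    outside g t * g (vtx u) (vtx v) = outside g v * g (vtx t) (vtx u).
  move=> tu tv uv; rewrite [RHS]mulrC; apply: toric_outside.
  by rewrite /= !inE negb_or tu tv uv.
have lift_eq (t u : 'I_(n i)) : (lift (@ord0 (n i)) t == lift ord0 u) = (t == u).
  exact: (inj_eq (@lift_inj _ ord0)).
split=> [a b|a|a b c e|a].
- by rewrite !mxE; case: (unlift ord0 a) (unlift ord0 b) => [t|] [u|].
- by rewrite mxE; case: (unlift ord0 a) => [t|//]; rewrite coordxx.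
- rewrite !mxE.
  case: (unliftP ord0 a) => [t|] ->; case: (unliftP ord0 b) => [u|] ->;
  case: (unliftP ord0 c) => [v|] ->; case: (unliftP ord0 e) => [w|] ->;
  rewrite /= ?inE ?eqxx ?orbT ?andbF //= ?lift_eq => abce.
  + by apply: within; rewrite /= !inE.
  + case/and3P: abce; rewrite !negb_or => /and3P[tu tv _] /andP[uv _] _.
    by rewrite mulrC out3 ?(eq_sym v) // (gC (vtx v)) mulrC.
  + case/and3P: abce; rewrite negb_or => /andP[tu tw] uw _.
    by rewrite mulrC -out3.
  + case/and3P: abce; rewrite negb_or => /andP[tv tw] vw _.
    by rewrite out3 // mulrC.
  + case/and3P: abce; rewrite negb_or => /andP[uv uw] vw _.
    by rewrite (gC (vtx v)) out3 // eq_sym.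
have [t ->|->] := unliftP ord0 a; rewrite big_ord_recl mxE ?liftK unlift_none.
  rewrite /collapsed_degree liftK degree_split; congr (_ + _).
  by apply: eq_bigr => u _; rewrite mxE !liftK.
rewrite add0r /collapsed_degree unlift_none -sum_outside.
by apply: eq_bigr => u _; rewrite mxE unlift_none liftK.
Qed.

End Toric.

Lemma decouple_inj u p p' : (forall i, total u i != 0) ->
  likelihood_eqs u p -> likelihood_eqs u p' ->
  (forall i, collapse (coord p) i = collapse (coord p') i) -> p = p'.
Proof.
move=> T0 /likelihood_eqsE[_ Sp torp] /likelihood_eqsE[_ Sp' torp'] pp'.
apply: coord_inj => -[i t] [j w].
have [ij|ij] := eqVneq i j.
  subst j; have /matrixP/(_ (lift ord0 t) (lift ord0 w)) := pp' i.
  by rewrite !mxE !liftK.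
have out_eq (l : 'I_k) (v : 'I_(n l)) : outside (coord p) v = outside (coord p') v.
  have /matrixP/(_ ord0 (lift ord0 v)) := pp' l.
  by rewrite !mxE !liftK unlift_none.
have Tp (q : point) l : (forall i j, block_sum (coord q) i j = block_sum (coord u) i j) ->
    total q l = total u l.
  by move=> Sq; apply: eq_bigr => l' _.
apply: (mulIf (mulf_neq0 (T0 i) (T0 j))).
have := toric_cross torp t w ij; rewrite !Tp // => ->.
have := toric_cross torp' t w ij; rewrite !Tp // => ->.
by rewrite Sp Sp' !out_eq.
Qed.

(** The weights within the blocks are those of [M]; between blocks [i] and [j] they
    are the only ones that [toric_cross] allows. *)
Lemma decouple_build u (M : forall i, 'M[K]_((n i).+1)) :
  (forall i, total u i != 0) ->
  (forall i, complete_sol (collapsed_degree (coord u) (i := i)) (M i)) ->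
  exists p, likelihood_eqs u p /\ forall i, collapse (coord p) i = M i.
Proof.
move=> T0 Msol; pose X (x : vertex) := M (tag x) ord0 (lift ord0 (tagged x)).
pose S i j := block_sum (coord u) i j.
pose G (x y : vertex) : K :=
  if tag x == tag y
  then M (tag x) (lift ord0 (tagged x)) (lift ord0 (tagged_as x y))
  else S (tag x) (tag y) * X x * X y / (total u (tag x) * total u (tag y)).
have SC i j : S i j = S j i by exact: block_sumC.
have G_in i (t w : 'I_(n i)) : G (vtx t) (vtx w) = M i (lift ord0 t) (lift ord0 w).
  by rewrite /G /= eqxx tagged_asE.
have G_out i j (t : 'I_(n i)) (w : 'I_(n j)) : i != j ->
    G (vtx t) (vtx w) = S i j * X (vtx t) * X (vtx w) / (total u i * total u j).
  by rewrite /G /= => /negbTE->.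
have [p pG] : exists p, forall x y, coord p x y = G x y.
  apply: coord_exists => [[i t] [j w]|[i t]].
    have [ij|ij] := eqVneq i j.
      by subst j; rewrite !G_in; case: (Msol i).
    rewrite (G_out _ _ t w) // (G_out _ _ w t) 1?eq_sym // (SC j i).
    by field; rewrite !T0.
  by rewrite G_in; case: (Msol i).
have sumX i : \sum_(t : 'I_(n i)) X (vtx t) = total u i.
  have [_ Mdiag _ /(_ ord0)] := Msol i.
  by rewrite big_ord_recl Mdiag add0r /collapsed_degree unlift_none.
have in_eq i (t w : 'I_(n i)) : coord p (vtx t) (vtx w) = M i (lift ord0 t) (lift ord0 w).
  by rewrite pG G_in.
have sum_cross i j (t : 'I_(n i)) : i != j ->
    \sum_(w : 'I_(n j)) coord p (vtx t) (vtx w) = S i j * X (vtx t) / total u i.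
  move=> ij; under eq_bigr do rewrite pG G_out //.
  by rewrite -mulr_suml -mulr_sumr sumX; field; rewrite !T0.
have outX i (t : 'I_(n i)) : outside (coord p) t = X (vtx t).
  transitivity (\sum_(j | j != i) S i j * X (vtx t) / total u i).
    by apply: eq_bigr => j ji; rewrite sum_cross // eq_sym.
  by rewrite -!mulr_suml mulrAC divff ?mul1r.
have coll i : collapse (coord p) i = M i.
  have [Msym Mdiag _ _] := Msol i; apply/matrixP => a b; rewrite mxE.
  have [t ->|->] := unliftP ord0 a; have [w ->|->] := unliftP ord0 b; rewrite /=.
  - by rewrite in_eq.
  - by rewrite outX Msym.
  - by rewrite outX.
  - by rewrite Mdiag.
exists p; split=> //; apply/likelihood_eqsE.
have deg x : \sum_y coord p x y = \sum_y coord u x y.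
  case: x => i t; rewrite -/(vtx t) (degree_split (coord p)) outX.
  have [Msym _ _ /(_ (lift ord0 t))] := Msol i; rewrite /collapsed_degree liftK => <-.
  rewrite big_ord_recl Msym; congr (_ + _).
  by apply: eq_bigr => w _; rewrite in_eq.
split=> // [i j|].
  have [<-|ij] := eqVneq i j.
    have sum_in q : block_sum (coord q) i i =
        \sum_(t : 'I_(n i)) (\sum_y coord q (vtx t) y - outside (coord q) t).
      by apply: eq_bigr => t _; rewrite degree_split addrC addKr.
    rewrite !sum_in !sumrB; congr (_ - _).
      by apply: eq_bigr => t _; rewrite deg.
    by rewrite [RHS]sum_outside -sumX; apply: eq_bigr => t _.
  rewrite /block_sum; under eq_bigr do rewrite sum_cross //.
  by rewrite -mulr_suml -mulr_sumr sumX mulfK.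
split.
- move=> i t v w z tvwz; apply/eqP; rewrite subr_eq0 !in_eq; apply/eqP.
  case: (Msol i) => _ _ M4 _; apply: M4.
  by rewrite (map_inj_uniq (@lift_inj _ ord0) [:: t; v; w; z]).
- move=> i j t v z w ij tvz; rewrite !in_eq !pG !G_out //.
  have : X (vtx t) * M i (lift ord0 v) (lift ord0 z) =
         M i (lift ord0 t) (lift ord0 v) * X (vtx z).
    case: (Msol i) => Msym _ M4 _; rewrite /X /= [RHS]mulrC.
    rewrite (Msym (lift ord0 v)); apply: M4.
    move: tvz; rewrite /= !inE !negb_or => /and3P[/andP[tv tz] vz _].
    by rewrite !(inj_eq (@lift_inj _ ord0)) tz tv eq_sym vz.
  move=> E; apply/eqP; rewrite subr_eq0; apply/eqP.
  transitivity (S i j * X (vtx w) / (total u i * total u j) *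
                (X (vtx t) * M i (lift ord0 v) (lift ord0 z))); first by ring.
  by rewrite E; ring.
- by move=> i j t v w z ij _ _; rewrite !pG !G_out //; ring.
- move=> i j l t v w z; rewrite /= !inE negb_or => /and3P[/andP[ij il] jl _] _.
  by rewrite !pG !G_out //; ring.
Qed.
End Decoupling.

(** * Counting product families *)

(** A bijection with ['I_d] rather than a cardinal equality, as products of
    solution sets are formed from such enumerations. *)
Definition counted (T : Type) (S : T -> Prop) (d : nat) : Prop :=
  exists2 f : 'I_d -> T, injective f & forall x, S x <-> exists i, f i = x.

Lemma counted_card_eq (T : Type) (S : set T) d : counted S d -> (S #= `I_d)%card.
Proof.
case=> f finj Sf; have -> : S = (f @` classical_sets.setT)%classic.
  apply/predeqP => x; split=> [Sx|[i _ <-]]; last by apply/(proj2 (Sf _)); exists i.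
  by have [i <-] := proj1 (Sf x) Sx; exists i.
by apply: card_eq_trans (inj_card_eq _) (card_esym card_II) => i j _ _; apply: finj.
Qed.

Lemma counted_complete_sol (K : numClosedFieldType) m : (3 < m)%N ->
  generic (fun d : 'I_m -> K => counted (complete_sol d) (2 ^ m.-1 - m)).
Proof.
case: m => // m m3; have m2 : (2 < m.+1)%N := ltnW m3.
have := generic_and (generic_and (nonzero_generic K m.+1) (unbalanced_generic K m.+1))
  (generic_and (no_signed_sum_generic K m.+1)
     (generic_and (no_branch_generic K m2) (simple_elim_generic K m2))).
by apply: generic_imp => d [[d0 ub] [ns [nb se]]]; apply: complete_count.
Qed.

Lemma counted_unique (T : Type) (S : T -> Prop) x :
  S x -> (forall y, S y -> y = x) -> counted S 1.
Proof.
move=> Sx Suniq; exists (fun=> x) => [i j _|y]; first by rewrite !ord1.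
by split=> [/Suniq->|[_ <-] //]; exists ord0.
Qed.

Lemma counted_edge (K : numFieldType) (d : 'I_2 -> K) :
  d ord0 = d ord_max -> counted (complete_sol d) 1.
Proof.
move=> d01; have sum2 (F : 'I_2 -> K) : \sum_i F i = F ord0 + F ord_max.
  by rewrite big_ord_recl big_ord1; congr (_ + F _); apply: val_inj.
have I2 (a : 'I_2) : a = ord0 \/ a = ord_max.
  by case: a => -[|[|//]] lt; [left|right]; apply: val_inj.
apply: (@counted_unique _ _ (\matrix_(a < 2, b < 2) ((a != b)%:R * d ord0))).
  split=> [a b|a|a b c e abce|a].
  - by rewrite !mxE eq_sym.
  - by rewrite mxE eqxx mul0r.
  - by have := max_card (mem [:: a; b; c; e]); rewrite (card_uniqP abce) card_ord.
  - rewrite sum2 !mxE; case: (I2 a) => ->; rewrite !eqxx /= mul0r mul1r ?add0r ?addr0 //.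
move=> M [Msym Mdiag _ Mdeg]; have M01 : M ord0 ord_max = d ord0.
  by rewrite -Mdeg sum2 Mdiag add0r.
apply/matrixP => a b; rewrite mxE.
case: (I2 a) (I2 b) => -> [] ->; rewrite ?eqxx ?mul0r ?mul1r ?Mdiag //.
by rewrite Msym.
Qed.

Lemma counted_triangle (K : numFieldType) (d : 'I_3 -> K) :
  counted (complete_sol d) 1.
Proof.
pose s := (\sum_a d a) / 2.
apply: (@counted_unique _ _ (\matrix_(a < 3, b < 3) ((a != b)%:R * (d a + d b - s)))).
  split=> [a b|a|a b c e abce|a].
  - by rewrite !mxE eq_sym [d a + _]addrC.
  - by rewrite mxE eqxx mul0r.
  - by have := max_card (mem [:: a; b; c; e]); rewrite (card_uniqP abce) card_ord.
  - rewrite (bigD1 a) //= mxE eqxx mul0r add0r.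
    rewrite (eq_bigr (fun b => d a + d b - s)) => [|b ba]; last first.
      by rewrite mxE eq_sym ba mul1r.
    have : \sum_b (d a + d b - s) = d a *+ 3 + s *+ 2 - s *+ 3.
      rewrite sumrB big_split /= !sumr_const card_ord; congr (_ + _ - _).
      by rewrite -(mulr_natr s) divfK ?pnatr_eq0.
    rewrite (bigD1 a) //= => /(canRL (addKr _)) ->; ring.
move=> M [Msym Mdiag _ Mdeg]; apply/matrixP => a b; rewrite mxE.
have [->|ab] := eqVneq a b; first by rewrite mul0r Mdiag.
have [c] := @fresh_ord 3 [:: a; b] isT; rewrite !inE negb_or => /andP[ca cb].
have sum3 (F : 'I_3 -> K) : \sum_i F i = F a + F b + F c.
  rewrite (bigD1 a) //= (bigD1 b) 1?eq_sym //= (bigD1 c) /= ?ca ?cb // big1 ?addr0 ?addrA //.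
  move=> e /andP[/andP[ea eb] ec].
  have : uniq [:: a; b; c; e].
    by rewrite /= !inE !negb_or ab !(eq_sym a) ca ea !(eq_sym b) cb eb eq_sym ec.
  by move/card_uniqP => abce; have := max_card (mem [:: a; b; c; e]); rewrite abce card_ord.
rewrite mul1r /s sum3 -!Mdeg !sum3 !Mdiag (Msym b a) (Msym c a) (Msym c b).
by field.
Qed.

Lemma counted_small (K : numFieldType) m (d : 'I_m.+1 -> K) :
  (0 < m <= 2)%N -> (m = 1%N -> forall a, d a = d ord0) ->
  counted (complete_sol d) 1.
Proof.
case: m d => [|[|[|//]]] // d _ d01; last exact: counted_triangle.
by apply: counted_edge; rewrite (d01 _ ord_max).
Qed.

(** If elements satisfying [P] are faithfully described by arbitrary families of
    components [c i] satisfying [S i], the counts multiply. *)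
Lemma counted_dffun (I : finType) (D : I -> nat) (T : I -> Type) (U : Type)
    (S : forall i, T i -> Prop) (P : U -> Prop) (c : forall i, U -> T i) :
  (forall i, counted (S i) (D i)) ->
  (forall x i, P x -> S i (c i x)) ->
  (forall x y, P x -> P y -> (forall i, c i x = c i y) -> x = y) ->
  (forall t : forall i, T i, (forall i, S i (t i)) ->
     exists2 x, P x & forall i, c i x = t i) ->
  counted P (\prod_i D i)%N.
Proof.
move=> /(_ _)/cid2 F PS Pinj Psurj.
pose f i : 'I_(D i) -> T i := s2val (F i).
have f_inj i : injective (f i) := s2valP (F i).
have fP i x : S i x <-> exists j, f i j = x := s2valP' (F i) x.
pose X : finType := {dffun forall i, 'I_(D i)}.
have cardX : #|X| = (\prod_i D i)%N.
  rewrite card_dep_ffun foldrE big_map big_enum.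
  by apply: eq_bigr => i _; rewrite card_ord.
have /choice[g gP] (e : X) : exists x, P x /\ forall i, c i x = f i (e i).
  have [i|x Px cx] := Psurj (fun i => f i (e i)); last by exists x.
  by apply/fP; exists (e i).
rewrite -cardX; exists (fun r : 'I_#|X| => g (enum_val r)) => [r s E|x].
  apply/enum_val_inj/ffunP => i; apply: f_inj.
  by rewrite -(proj2 (gP _)) -(proj2 (gP (enum_val s))) E.
split=> [Px|[r <-]]; last exact: (proj1 (gP _)).
have /(_ _)/cid e i : exists j, f i j = c i x by apply: (proj1 (fP _ _)); apply: PS.
exists (enum_rank ([ffun i => projT1 (e i)] : X)); rewrite enum_rankK.
apply: Pinj => //; first exact: (proj1 (gP _)).
by move=> i; rewrite (proj2 (gP _)) ffunE (projT2 (e i)).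
Qed.

(** * The maximum likelihood degree *)

Section Genericity.
Variables (K : numFieldType).

(** A proper closed set lies in the zero set of one nonzero polynomial. *)
Lemma generically_generic m (P : 'cV[K]_m -> Prop) :
  generically P <-> generic (fun v => P (\col_j v j)).
Proof.
have colK (u : 'cV[K]_m) : \col_j u j ord0 = u.
  by apply/matrixP => i j; rewrite mxE (ord1 j).
split=> [[Z [[F ZF] ZT ZP]]|[g g0 gP]].
  have [u nZu] : exists u, ~ Z u.
    apply: contrapT => allZ; apply: ZT; apply/predeqP => u; split=> // _.
    by apply: contrapT => nZ; apply: allZ; exists u.
  have [f Ff fu] : exists2 f, F f & f.@[fun j => u j ord0] != 0.
    apply: contrapT => nof; apply: nZu; apply/ZF => f Ff; apply/eqP.
    by apply: contrapT => /negP fu; apply: nof; exists f.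
  exists f => [|v fv]; first by apply: contraNneq fu => ->; rewrite meval0.
  apply: ZP => /ZF/(_ f Ff)/eqP; apply/negP; rewrite -(meval_eq (v1 := v)) // => j.
  by rewrite mxE.
exists (fun u => g.@[fun j => u j ord0] = 0); split.
- exists (fun f => f = g) => u; split=> [gu f ->|] //; exact.
- have [v gv] := mpoly_nonroot g0.
  move=> /predeqP/(_ (\col_j v j))[_ /(_ I)] /eqP; apply/negP.
  by rewrite -(meval_eq (v1 := v)) // => j; rewrite mxE.
- by move=> u /eqP gu; rewrite -(colK u); apply: gP.
Qed.

End Genericity.

Section GenericCounting.
Variables (K : numClosedFieldType) (k : nat) (n : 'I_k -> nat).
Hypotheses (k1 : (1 < k)%N) (n0 : forall i, (0 < n i)%N).
Local Notation vertex := (vertex n).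
Local Notation N := #|edge n|.
Local Notation total u i := (\sum_(j | j != i) block_sum (coord u) i j).

Definition coord_mpoly (x y : vertex) : {mpoly K[N]} :=
  \sum_e ([set x; y] == val e)%:R * 'X_(enum_rank e).

Lemma meval_coord (v : 'I_N -> K) x y :
  (coord_mpoly x y).@[v] = coord (\col_j v j) x y.
Proof.
rewrite coordE raddf_sum; apply: eq_bigr => e _ /=.
by rewrite mevalM mevalXU mxE rmorph_nat.
Qed.

Lemma meval_collapsed_degree (v : 'I_N -> K) i (a : 'I_(n i).+1) :
  (collapsed_degree coord_mpoly a).@[v] = collapsed_degree (coord (\col_j v j)) a.
Proof.
rewrite /collapsed_degree; case: (unlift ord0 a) => [t|].
  by rewrite raddf_sum; apply: eq_bigr => y _; apply: meval_coord.
rewrite raddf_sum; apply: eq_bigr => j _ /=; rewrite raddf_sum; apply: eq_bigr => t _ /=.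
by rewrite raddf_sum; apply: eq_bigr => w _; apply: meval_coord.
Qed.

Lemma other_vertex i : exists y : vertex, tag y != i.
Proof.
have [j] := @fresh_ord k [:: i] k1; rewrite inE => ji.
by exists (vtx (Ordinal (n0 j))).
Qed.

Lemma total_generic : generic (fun v : 'I_N -> K => forall i, total (\col_j v j) i != 0).
Proof.
apply: generic_forall => i.
have gE (v : 'I_N -> K) : (collapsed_degree coord_mpoly (ord0 : 'I_(n i).+1)).@[v] =
    total (\col_j v j) i.
  by rewrite meval_collapsed_degree /collapsed_degree unlift_none.
apply: (generic_imp (P := fun v =>
  (collapsed_degree coord_mpoly (ord0 : 'I_(n i).+1)).@[v] != 0)).
  by move=> v; rewrite gE.
have [p pE] : exists p : 'cV[K]_N, forall x y, coord p x y = (x != y)%:R.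
  by apply: coord_exists => [x y|x]; rewrite ?eqxx // eq_sym.
apply: generic_neq0; exists (fun j => p j ord0).
have -> : (collapsed_degree coord_mpoly (ord0 : 'I_(n i).+1)).@[fun j => p j ord0] =
    (\sum_(j | j != i) n i * n j)%N%:R.
  rewrite gE (_ : \col_j _ = p); last by apply/matrixP => r c; rewrite mxE (ord1 c).
  rewrite natr_sum; apply: eq_bigr => j ji.
  rewrite /block_sum (eq_bigr (fun=> (n j)%:R)) => [|t _].
    by rewrite sumr_const card_ord natrM mulr_natl.
  rewrite (eq_bigr (fun=> 1)) => [|w _]; first by rewrite sumr_const card_ord.
  rewrite pE; case: eqP => // tw; case/eqP: ji.
  by rewrite -[j]/(tag (vtx w)) -tw.
rewrite pnatr_eq0 -lt0n; have [y yi] := other_vertex i.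
by rewrite (bigD1 (tag y)) //= addn_gt0 muln_gt0 !n0.
Qed.

(** With [Z] the sum of the [z b], the sum is [(m - 2) * z a + Z]; summing over [a]
    gives [Z], half the sum of the degrees divided by [m - 1]. *)
Lemma degree_realizable m (d : 'I_m -> K) : (2 < m)%N ->
  exists z : 'I_m -> K, forall a, \sum_(b | b != a) (z a + z b) = d a.
Proof.
case: m d => // m d m2; have m0 : m%:R != 0 :> K by rewrite pnatr_eq0 -lt0n ltnW.
have m1 : m%:R - 1 != 0 :> K by rewrite subr_eq0 (eqr_nat K m 1) gtn_eqF.
pose c := (\sum_a d a) / (m%:R *+ 2); pose z a := (d a - c) / (m%:R - 1).
have sumz : \sum_a z a = c.
  rewrite -mulr_suml sumrB sumr_const card_ord -[c *+ _]mulr_natr -natr1.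
  have -> : \sum_a d a = c * (m%:R *+ 2).
    by rewrite divfK // mulrn_eq0.
  by field.
exists z => a; have : \sum_b (z a + z b) = z a * m.+1%:R + c.
  by rewrite big_split /= sumz sumr_const card_ord mulr_natr.
rewrite (bigD1 a) //= => /(canRL (addKr _)) ->; rewrite -natr1 /z.
by field.
Qed.

(** Any degrees of the collapsed graph are reached from a complete graph on the
    block and one vertex [y0] outside of it. *)
Lemma collapsed_degree_surj i (d : 'I_(n i).+1 -> K) : (2 < n i)%N ->
  exists v : 'I_N -> K, forall a, (collapsed_degree coord_mpoly a).@[v] = d a.
Proof.
move=> ni; have [z zd] := degree_realizable d (ltnW ni).
have [y0 y0i] := other_vertex i.
pose em (a : 'I_(n i).+1) : vertex := if unlift ord0 a is Some t then vtx t else y0.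
have em0 : em ord0 = y0 by rewrite /em unlift_none.
have emL t : em (lift ord0 t) = vtx t by rewrite /em liftK.
have em_inj : injective em.
  move=> a b; have [t ->|->] := unliftP ord0 a; have [w ->|->] := unliftP ord0 b;
    rewrite ?em0 ?emL //.
  - by move/eqP; rewrite eq_Tagged /= => /eqP ->.
  - by move=> E; rewrite -E eqxx in y0i.
  - by move=> E; rewrite E eqxx in y0i.
pose W a b : K := (a != b)%:R * (z a + z b).
have WC a b : W a b = W b a by rewrite /W eq_sym addrC.
pose G x y : K := \sum_a \sum_b (x == em a)%:R * (y == em b)%:R * W a b.
have GC x y : G x y = G y x.
  rewrite /G exchange_big; apply: eq_bigr => a _; apply: eq_bigr => b _.
  by rewrite WC [(x == _)%:R * _]mulrC.
have Gxx x : G x x = 0.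
  rewrite /G big1 // => a _; rewrite big1 // => b _.
  case: eqP => [->|_]; last by rewrite !mul0r.
  by rewrite (inj_eq em_inj) /W; case: eqVneq; rewrite ?(mulr0, mul0r).
have [p pG] := coord_exists GC Gxx.
have sumG a (P : pred vertex) :
    \sum_(y | P y) coord p (em a) y = \sum_(b | P (em b)) W a b.
  transitivity (\sum_(y | P y) \sum_b (y == em b)%:R * W a b).
    apply: eq_bigr => y _; rewrite pG /G (bigD1 a) //= [X in _ + X]big1 ?addr0.
      by apply: eq_bigr => b _; rewrite eqxx mul1r.
    move=> a' a'a; rewrite big1 // => b _.
    by rewrite (inj_eq em_inj) eq_sym (negbTE a'a) !mul0r.
  rewrite exchange_big [RHS]big_mkcond; apply: eq_bigr => b _ /=.
  case: ifP => Pb; last first.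
    by rewrite big1 // => y Py; case: eqP Py => [->|]; rewrite ?Pb ?mul0r.
  rewrite (bigD1 (em b)) //= eqxx mul1r big1 ?addr0 // => y /andP[_ /negbTE->].
  by rewrite mul0r.
have sumW a : \sum_b W a b = d a.
  rewrite -zd [RHS]big_mkcond; apply: eq_bigr => b _; rewrite /W eq_sym.
  by case: (b == a); rewrite ?mul0r ?mul1r.
exists (fun j => p j ord0) => a; rewrite meval_collapsed_degree.
rewrite (_ : \col_j _ = p); last by apply/matrixP => r c; rewrite mxE (ord1 c).
rewrite /collapsed_degree; have [t ->|->] := unliftP ord0 a.
  by rewrite -emL sumG sumW.
rewrite -sum_outside -sumW big_ord_recl {1}/W eqxx mul0r add0r.
apply: eq_bigr => t _; rewrite /outside -(sum_vertex _ (fun j => j != i)) -emL sumG.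
rewrite big_mkcond big_ord_recl em0 y0i big1 ?addr0 => [|w _]; last by rewrite emL eqxx.
by rewrite /= addr0 WC.
Qed.

Definition block_count m := if (2 < m)%N then (2 ^ m - (m + 1))%N else 1%N.

Lemma block_counted_generic i :
  generic (fun v : 'I_N -> K =>
    counted (complete_sol (collapsed_degree (coord (\col_j v j)) (i := i))) (block_count (n i))).
Proof.
rewrite /block_count; case: ltnP => ni.
  have cnt := @counted_complete_sol K (n i).+1 ni.
  have := generic_comp (fun d => collapsed_degree_surj d ni) cnt.
  apply: generic_imp => v; rewrite addn1 /=; congr counted; congr complete_sol.
  by apply: functional_extensionality_dep => a; apply: meval_collapsed_degree.
exists 1; rewrite ?oner_neq0 // => v _; apply: counted_small => [|ni1 a]; first by rewrite n0 ni.
have ord_eq0 (t : 'I_(n i)) : t = 0%N :> nat.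
  by apply/eqP; rewrite -leqn0; apply: leq_trans (ltn_ord t) (eq_leq ni1).
have one (t t' : 'I_(n i)) : t = t' by apply: val_inj; rewrite /= !ord_eq0.
rewrite /collapsed_degree unlift_none -sum_outside; case: (unlift ord0 a) => // t.
rewrite degree_split [X in _ + X]big1 => [|u _]; last first.
  by rewrite (one u t) coordxx.
by rewrite addr0 (bigD1 t) //= big1 ?addr0 // => u /eqP[]; apply: one.
Qed.

Lemma solution_count_generic :
  generic_solution_count K n (\prod_i block_count (n i)).
Proof.
apply/generically_generic.
have := generic_and total_generic (generic_forall block_counted_generic).
apply: generic_imp => v [T0 cnt]; apply: counted_card_eq.
apply: (counted_dffun cnt (c := fun i p => collapse (coord p) i)) => [p i pu|p q pu qu|M Msol].
- have /likelihood_eqsE[deg sum tor] := pu; have := toric_collapse tor i.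
  congr complete_sol; apply: functional_extensionality_dep => a.
  rewrite /collapsed_degree; case: (unlift ord0 a) => [t|]; first exact: deg.
  by apply: eq_bigr => j _; apply: sum.
- exact: (decouple_inj T0 pu qu).
- by have [p [pu pM]] := decouple_build T0 Msol; exists p.
Qed.

End GenericCounting.

(** Two generic properties hold together at some point, so the generic number of
    solutions is unique. *)
Lemma MLdegE (R : realType) k (n : 'I_k -> nat) :
  (1 < k)%N -> (forall i, 0 < n i)%N -> MLdeg R n = (\prod_i block_count (n i))%N.
Proof.
move=> k1 n0; have cnt := @solution_count_generic R[i] k n k1 n0.
apply: xget_unique => // d' cnt'.
have /generically_generic g := cnt; have /generically_generic g' := cnt'.
have [v [vd vd']] := generic_nonempty (generic_and g g').
by apply/card_eq_II; apply: card_eq_trans vd; rewrite card_eq_sym.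
Qed.

Local Close Scope ring_scope.

Theorem corollary3p4 (R : realType) (k : nat) (n : 'I_k -> nat)
    (hk : 1 < k) (hn : forall i, 0 < n i) :
  let N := [set i : 'I_k | 2 < n i] in
  (N != set0 ->
     MLdeg R n = \prod_(i in N) MLdeg R (tnth [tuple n i; 1]) /\
     \prod_(i in N) MLdeg R (tnth [tuple n i; 1]) =
       \prod_(i in N) (2 ^ n i - (n i + 1))) /\
  (N = set0 -> MLdeg R n = 1).
Proof.
have prodE k' (n' : 'I_k' -> nat) :
    \prod_i block_count (n' i) = \prod_(i | 2 < n' i) (2 ^ n' i - (n' i + 1)).
  by rewrite [RHS]big_mkcond.
have tupE i : MLdeg R (tnth [tuple n i; 1]) = block_count (n i).
  rewrite MLdegE // => [|j]; last by case: j => -[|[|//]] lt; rewrite (tnth_nth 0) /= ?hn.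
  by rewrite !big_ord_recl big_ord0 !(tnth_nth 0) /= [block_count 1]/block_count /= !muln1.
move=> N; have NE : \prod_(i in N) (2 ^ n i - (n i + 1)) = \prod_i block_count (n i).
  by rewrite prodE; apply: eq_bigl => i; rewrite inE.
have tupN : \prod_(i in N) MLdeg R (tnth [tuple n i; 1]) =
    \prod_(i in N) (2 ^ n i - (n i + 1)).
  by apply: eq_bigr => i; rewrite tupE inE /block_count => ->.
split=> [_|N0]; first by rewrite tupN NE MLdegE.
by rewrite MLdegE // -NE N0 big_set0.
Qed.
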